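(* Let $(M_i)_{i\in\mathbb{Z}}$ be a two-sided sequence of compact Riemannian manifolds with disjoint union $\mathbf{M}$ (equipped with the Riemannian metric $\langle\cdot,\cdot\rangle$ that restricts to the given metric on each $M_i$). The set $\mathcal{A}(\mathbf{M})$ of Anosov families on $(\mathbf{M},\langle\cdot,\cdot\rangle)$ is open in $\mathcal{F}(\mathbf{M})$ for the strong topology; that is, for every $\mathbf{f}\in\mathcal{A}(\mathbf{M})$ there is a sequence of positive numbers $\varepsilon=(\varepsilon_i)_{i\in\mathbb{Z}}$ such that $B(\mathbf{f},\varepsilon)\subseteq\mathcal{A}(\mathbf{M})$.
   Context: $(M_i,\langle\cdot,\cdot\rangle_i)_{i\in\mathbb{Z}}$ is a two-sided sequence of compact Riemannian manifolds, $\mathbf{M}=\coprod_{i\in\mathbb{Z}}M_i$, $\langle\cdot,\cdot\rangle|_{M_i}=\langle\cdot,\cdot\rangle_i$, and $\|\cdot\|$ is the induced norm on $T\mathbf{M}$. $\mathcal{F}(\mathbf{M})$ is the set of sequences $\mathbf{f}=(f_i)_{i\in\mathbb{Z}}$ of $C^1$-diffeomorphisms $f_i:M_i\to M_{i+1}$, regarded as maps $\mathbf{f}:\mathbf{M}\to\mathbf{M}$ with $\mathbf{f}|_{M_i}=f_i$. For $n\ge1$ put $\mathbf{f}_i^{n}=f_{i+n-1}\circ\cdots\circ f_i:M_i\to M_{i+n}$ and $\mathbf{f}_i^{-n}=f_{i-n}^{-1}\circ\cdots\circ f_{i-1}^{-1}:M_i\to M_{i-n}$. Strong topology: for a sequence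 $\varepsilon=(\varepsilon_i)_{i\in\mathbb{Z}}$ of positive numbers, $B(\mathbf{f},\varepsilon)=\{\mathbf{g}=(g_i)\in\mathcal{F}(\mathbf{M}): d_{\mathbf{D}_i}(f_i,g_i)<\varepsilon_i \text{ for all } i\}$, where $d_{\mathbf{D}_i}$ is the $C^1$-metric on $\mathbf{D}_i=\mathrm{Diff}^1(M_i,M_{i+1})$, the set of $C^1$-diffeomorphisms from $M_i$ to $M_{i+1}$. The strong topology is generated by the sets $B(\mathbf{f},\varepsilon)$. $\mathbf{f}\in\mathcal{F}(\mathbf{M})$ is an Anosov family on $(\mathbf{M},\langle\cdot,\cdot\rangle)$ if: (i) $T\mathbf{M}$ has a continuous splitting $E^s\oplus E^u$ that is $D\mathbf{f}$-invariant, i.e. for each $p$, $T_p\mathbf{M}=E^s_p\oplus E^u_p$, $D_p\mathbf{f}(E^s_p)=E^s_{\mathbf{f}(p)}$, $D_p\mathbf{f}(E^u_p)=E^u_{\mathbf{f}(p)}$; (ii) there are constants $\lambda\in(0,1)$, $c>0$ such that for all $i\in\mathbb{Z}$, $n\ge1$, $p\in M_i$: $\|D_p(\mathbf{f}_i^{n})(v)\|\le c\lambda^n\|v\|$ for $v\in E^s_p$ and $\|D_p(\mathbf{f}_i^{-n})(v)\|\le c\lambda^n\|v\|$ for $v\in E^u_p$. *)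

(* Defs.v *)
From HB Require Import structures.
From mathcomp Require Import all_boot all_order all_algebra.
From mathcomp Require Import all_classical all_reals all_analysis.

Set Implicit Arguments.
Unset Strict Implicit.
Unset Printing Implicit Defensive.

Import Order.TTheory GRing.Theory Num.Theory.
Import numFieldNormedType.Exports.

Local Open Scope classical_set_scope.
Local Open Scope ring_scope.

(* f is of class C^k on U; meant for U open, so that only the values of f on U
   matter.  f is C^(k+1) when it is differentiable and x |-> 'd f x v is C^k
   for every v, which is the usual notion as V is finite dimensional below. *)
Fixpoint Ck_on (R : realType) (V W : normedModType R) (k : nat) (U : set V)
    (f : V -> W) : Prop :=
  match k with
  | 0 => forall x, U x -> {for x, continuous f}
  | k'.+1 => (forall x, U x -> differentiable f x) /\
             (forall v, Ck_on k' U (fun x => 'd f x v))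
  end.

Definition smooth_on (R : realType) (V W : normedModType R) (U : set V)
  (f : V -> W) : Prop := forall k, Ck_on k U f.

(* A homeomorphism from an open subset of T onto an open subset of R^n; cfwd
   and cbwd are total, their values outside cdom and cim being irrelevant. *)
Record chart (R : realType) (T : topologicalType) (n : nat) := Chart {
  cdom : set T;
  cfwd :> T -> 'rV[R]_n;
  cbwd : 'rV[R]_n -> T;
  cdom_open : open cdom;
  cim_open : open (cfwd @` cdom);
  cfwdK : forall p, cdom p -> cbwd (cfwd p) = p;
  cfwd_continuous : forall p, cdom p -> {for p, continuous cfwd};
  cbwd_continuous : forall x, (cfwd @` cdom) x -> {for x, continuous cbwd} }.

Definition cim (R : realType) (T : topologicalType) (n : nat)
  (phi : chart R T n) : set 'rV[R]_n := phi @` cdom phi.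

(* Smooth manifolds without boundary.  chart_at selects a chart of the atlas
   around each point, and is only used to represent tangent vectors: an element
   of T_p M is identified with its vector of coordinates in chart_at p.  The
   carrier 'rV_(mdim M) of T_p M is thus the same for all p, but vectors at
   different points can only be compared through a common chart. *)
Record manifold (R : realType) := Manifold {
  mdim : nat;
  mcarrier :> topologicalType;
  mhausdorff : hausdorff_space mcarrier;
  msecond_countable : @second_countable mcarrier;
  atlas : set (chart R mcarrier mdim);
  atlas_compatible : forall phi psi, atlas phi -> atlas psi ->
    smooth_on (phi @` (cdom phi `&` cdom psi)) (psi \o cbwd phi);
  chart_at : mcarrier -> chart R mcarrier mdim;
  chart_at_atlas : forall p, atlas (chart_at p);
  chart_at_dom : forall p, cdom (chart_at p) p }.

(* The element of T_p M whose coordinates in the chart phi are u. *)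
Definition of_chart (R : realType) (M : manifold R) (phi : chart R M (mdim M))
  (p : M) (u : 'rV[R]_(mdim M)) : 'rV[R]_(mdim M) :=
  'd (chart_at p \o cbwd phi) (phi p) u.

Record riemannian (R : realType) := Riemannian {
  rmanifold :> manifold R;
  metric : forall p : rmanifold,
    'rV[R]_(mdim rmanifold) -> 'rV[R]_(mdim rmanifold) -> R;
  metric_linear : forall p v, scalar (fun u => metric p u v);
  metric_sym : forall p u v, metric p u v = metric p v u;
  metric_pos : forall p u, u != 0 -> 0 < metric p u u;
  metric_smooth : forall phi, atlas phi -> forall u v,
    smooth_on (cim phi) (fun x => let p := cbwd phi x in
      metric p (of_chart phi p u) (of_chart phi p v) : R^o) }.

Definition rnorm (R : realType) (M : riemannian R) (p : M)
  (v : 'rV[R]_(mdim M)) : R := Num.sqrt (metric p v v).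

Definition C1_map (R : realType) (M N : manifold R) (f : M -> N) : Prop :=
  continuous f /\
  forall (phi : chart R M (mdim M)) (psi : chart R N (mdim N)),
    atlas phi -> atlas psi ->
    Ck_on 1 (phi @` (cdom phi `&` f @^-1` cdom psi)) (psi \o f \o cbwd phi).

(* The differential D_p f : T_p M -> T_(f p) N of a C^1 map f. *)
Definition diff_map (R : realType) (M N : manifold R) (f : M -> N) (p : M) :
    'Hom('rV[R]_(mdim M), 'rV[R]_(mdim N)) :=
  linfun ('d (chart_at (f p) \o f \o cbwd (chart_at p)) (chart_at p p)).

(* Diff^1(M, N) *)
Record diffeo (R : realType) (M N : manifold R) := Diffeo {
  dfun :> M -> N;
  dinv : N -> M;
  dfunK : cancel dfun dinv;
  dinvK : cancel dinv dfun;
  dfun_C1 : C1_map dfun;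
  dinv_C1 : C1_map dinv }.

Definition is_topology (T : Type) (O : set (set T)) : Prop :=
  [/\ O setT, forall A B, O A -> O B -> O (A `&` B) &
      forall F : set (set T), F `<=` O -> O (\bigcup_(A in F) A)].

Definition generated_topology (T : Type) (G : set (set T)) : set (set T) :=
  smallest (@is_topology T) G.

(* Hirsch's subbasic neighbourhoods of f for the C^1 topology: the g with
   g(K) in cdom psi whose local representative and its first derivative are
   e-close to those of f on K. *)
Definition C1_nbhd (R : realType) (M N : manifold R) (f : diffeo M N)
    (phi : chart R M (mdim M)) (psi : chart R N (mdim N)) (K : set M) (e : R) :
    set (diffeo M N) :=
  [set g | g @` K `<=` cdom psi /\ forall x, (phi @` K) x ->
     `|psi (f (cbwd phi x)) - psi (g (cbwd phi x))| < e /\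
     forall v, `|v| <= 1 ->
       `|'d (psi \o f \o cbwd phi) x v - 'd (psi \o g \o cbwd phi) x v| < e].

Definition C1_topology (R : realType) (M N : manifold R) :
    set (set (diffeo M N)) :=
  generated_topology [set B | exists (f : diffeo M N)
      (phi : chart R M (mdim M)) (psi : chart R N (mdim N)) (K : set M) (e : R),
    [/\ atlas phi /\ atlas psi, compact K /\ K `<=` cdom phi,
        f @` K `<=` cdom psi, 0 < e & B = C1_nbhd f phi psi K e]].

Definition is_metric (R : realType) (T : Type) (d : T -> T -> R) : Prop :=
  [/\ forall x y, 0 <= d x y, forall x y, d x y = 0 <-> x = y,
      forall x y, d x y = d y x & forall x y z, d x z <= d x y + d y z].

Definition metric_open (R : realType) (T : Type) (d : T -> T -> R) :
    set (set T) :=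
  [set A | forall x, A x -> exists2 r, 0 < r & [set y | d x y < r] `<=` A].

(* The C^1 metric on Diff^1(M, N) is only canonical up to the choice of charts
   or of an embedding; d is one when it is a metric inducing the C^1
   topology. *)
Definition C1_metric (R : realType) (M N : manifold R)
    (d : diffeo M N -> diffeo M N -> R) : Prop :=
  is_metric d /\ metric_open d = @C1_topology R M N.

(* F(M) *)
Definition diffeo_family (R : realType) (M : int -> riemannian R) :=
  forall i : int, diffeo (M i) (M (i + 1)).

(* f_i^n : M_i -> M_(i+n); the index i + n is represented by
   iter n (fun j => j + 1) i so that the composition is well typed. *)
Fixpoint fwd_iter (R : realType) (M : int -> riemannian R)
    (f : diffeo_family M) (n : nat) (i : int) :
    M i -> M (iter n (fun j => j + 1) i) :=
  match n with
  | 0 => id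
  | n'.+1 => fun p => f (iter n' (fun j => j + 1) i) (fwd_iter f n' p)
  end.

(* f_(i-1)^-1 : M_i -> M_(i-1), where M_i is cast to M_(i-1+1). *)
Definition inv_step (R : realType) (M : int -> riemannian R)
    (f : diffeo_family M) (i : int) (p : M i) : M (i - 1) :=
  dinv (f (i - 1)) (ecast j (M j) (esym (subrK 1 i)) p).

(* f_i^-n : M_i -> M_(i-n) *)
Fixpoint bwd_iter (R : realType) (M : int -> riemannian R)
    (f : diffeo_family M) (n : nat) (i : int) :
    M i -> M (iter n (fun j => j - 1) i) :=
  match n with
  | 0 => id
  | n'.+1 => fun p => inv_step f (bwd_iter f n' p)
  end.

(* E is a continuous subbundle of TM: around every p0 there is a continuous
   local frame of E, given by its coordinates w in a fixed chart. *)
Definition continuous_subbundle (R : realType) (M : manifold R)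
    (E : M -> {vspace 'rV[R]_(mdim M)}) : Prop :=
  forall p0 : M, exists (k : nat) (w : 'I_k -> M -> 'rV[R]_(mdim M)),
    \forall p \near p0, (forall j, {for p, continuous (w j)}) /\
      basis_of (E p) [seq of_chart (chart_at p0) p (w j p) | j : 'I_k].

Record anosov_splitting (R : realType) (M : int -> riemannian R)
    (f : diffeo_family M)
    (Es Eu : forall i, M i -> {vspace 'rV[R]_(mdim (M i))}) :
    Prop := AnosovSplitting {
  Es_continuous : forall i, continuous_subbundle (@Es i);
  Eu_continuous : forall i, continuous_subbundle (@Eu i);
  EsEu_sum : forall i (p : M i), (Es i p + Eu i p = fullv)%VS;
  EsEu_cap : forall i (p : M i), (Es i p :&: Eu i p = 0)%VS;
  Es_invariant : forall i (p : M i),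
    (diff_map (f i) p @: Es i p)%VS = Es _ (f i p);
  Eu_invariant : forall i (p : M i),
    (diff_map (f i) p @: Eu i p)%VS = Eu _ (f i p);
  EsEu_hyperbolic : exists lam c : R, [/\ 0 < lam < 1, 0 < c &
    forall (i : int) (n : nat) (p : M i), (1 <= n)%N ->
      (forall v, v \in Es i p ->
         rnorm (fwd_iter f n p) (diff_map (@fwd_iter R M f n i) p v)
           <= c * lam ^+ n * rnorm p v) /\
      (forall v, v \in Eu i p ->
         rnorm (bwd_iter f n p) (diff_map (@bwd_iter R M f n i) p v)
           <= c * lam ^+ n * rnorm p v)] }.

(* A(M) *)
Definition anosov (R : realType) (M : int -> riemannian R) :
    set (diffeo_family M) :=
  [set f | exists Es Eu, anosov_splitting f Es Eu].

Definition strong_ball (R : realType) (M : int -> riemannian R)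
    (d : forall i, diffeo (M i) (M (i + 1)) -> diffeo (M i) (M (i + 1)) -> R)
    (f : diffeo_family M) (eps : int -> R) : set (diffeo_family M) :=
  [set g | forall i, d i (f i) (g i) < eps i].

Definition strong_topology (R : realType) (M : int -> riemannian R)
    (d : forall i, diffeo (M i) (M (i + 1)) -> diffeo (M i) (M (i + 1)) -> R) :
    set (set (diffeo_family M)) :=
  generated_topology [set B | exists f eps,
    (forall i, 0 < eps i) /\ B = strong_ball d f eps].

(* Main.v *)
(** Each direction of the Anosov splitting of f carries an adapted family of
    fibrewise seminorms: a z is a finite sum of the mu^-n |Df^n z_s| for n < n0,
    where c lam^n0 <= mu^n0, and b z is its analogue for the unstable component
    and the inverse family.  Then a (Df z) <= mu a z and b z <= mu b (Df z), and
    a, b are comparable with |z_s|, |z_u| with one constant C for all indices,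
    although the angle between the two subbundles is not controlled.

    If g is close enough to f in the strong topology, a and b evaluated on Dg z
    and on Df z differ by at most delta |z| with the same delta at all indices
    (compactness of each M_i).  Hence the cones b <= al a and a <= al b are
    respected by Dg, with expansion and contraction at the uniform rate rho.  The
    stable subspace of g at p is the set of vectors whose whole forward orbit
    stays in the stable cone; it is linear because a vector leaving the cone grows
    exponentially.  A cluster point argument shows that it is a complement of the
    unstable subspace of f, and a closed graph argument that it depends
    continuously on p.  The unstable one is obtained by reversing time and
    exchanging a and b.  With al = 1 / (2 C), a z is comparable with |z| inside the
    stable cone, so the rate rho transfers to the Riemannian norm. *)

Require Import Defs.
From HB Require Import structures.
From mathcomp Require Import all_boot all_order all_algebra.
From mathcomp Require Import all_classical all_reals all_analysis.
From mathcomp Require Import lra ring.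

Set Implicit Arguments.
Unset Strict Implicit.
Unset Printing Implicit Defensive.

Import Order.TTheory GRing.Theory Num.Theory.
Import numFieldNormedType.Exports.

Local Open Scope classical_set_scope.
Local Open Scope ring_scope.

(** * Differentials and charts *)

(** The geometry of f is controlled only index by index: the norms of the projections onto the two
    subbundles, and those of Df and its inverse, may be unbounded as the index varies. What is
    uniform is the triangle inequality, giving |z| <= a z + b z, and the comparison of a and b with
    the components of z. Every error delta |z| is therefore absorbed through delta (a z + b z), and
    no uniform bound of a or b by |z| is used before z is known to lie in a cone. In the stable cone
    the unstable component is at most half the stable one, which replaces a control of the angle.
    The gap 1 - mu is split in two halves: one pays for the errors, the other is what remains of
    hyperbolicity at the rate rho. The existence of enough stable vectors is a dimension count, and
    needs that Dg sends no nonzero stable vector of f to an unstable one; this calls for a third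
    closeness condition, because Df may contract stable vectors arbitrarily strongly. *)

Section DiffExtra.
Context {R : realType}.

(** The first order expansion of f at x is also one of g, and such expansions are unique. This makes
    the values of charts outside their domains harmless. *)
Lemma near_eq_diff (V W : normedModType R) (f g : V -> W) x :
  (\near x, f x = g x) -> differentiable f x ->
  differentiable g x /\ 'd g x = 'd f x :> (V -> W).
Proof.
move=> fg dxf; have [dfc fE] := (diff_locallyP x f).1 dxf.
have gE : g \o shift x = cst (g x) + 'd f x +o_0 id.
  apply/eqaddoP => _/posnumP[e].
  have /eqaddoP/(_ e%:num (gt0 e)) fe := fE.
  have fg0 : \forall h \near (0 : V), f (h + x) = g (h + x).
    move: fg; rewrite (near_shift 0)/=.
    by apply: filterS => h; rewrite /= subr0.
  apply: filterS2 fe fg0 => h /=.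
  by rewrite !fctE /cst/= => + <-; rewrite (nbhs_singleton fg).
have dgE := diff_unique dfc gE.
by split; [apply/diff_locallyP; rewrite dgE; split; [exact: dfc|exact: gE]|exact: dgE].
Qed.

Lemma cvg_rsum (V : normedModType R) (I : Type) (r : seq I) (P : pred I)
    (T : Type) (F : set_system T) {FF : Filter F} (f : I -> T -> V) (l : I -> V) :
  (forall i, P i -> f i t @[t --> F] --> l i) ->
  \sum_(i <- r | P i) f i t @[t --> F] --> \sum_(i <- r | P i) l i.
Proof. by move=> fl; apply: (cvg_big (op := +%R)) => //; exact: add_continuous. Qed.

Lemma cvg_continuous_comp (T : Type) (U V : topologicalType) (F : set_system T)
    {FF : Filter F} (h : U -> V) (f : T -> U) a :
  {for a, continuous h} -> f @ F --> a -> h (f t) @[t --> F] --> h a.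
Proof. exact: continuous_cvg. Qed.

Lemma near_cvg_eq (T : Type) (U : topologicalType) (F : set_system T)
    {FF : Filter F} (f g : T -> U) (l : U) :
  (\forall t \near F, f t = g t) -> f @ F --> l -> g @ F --> l.
Proof.
move=> fg fl A lA; have fA : F (f @^-1` A) := fl A lA.
by apply: filterS2 fg fA => t fgt /=; rewrite fgt.
Qed.

(** Only each directional derivative is assumed continuous; expanding the vector in the standard
    basis makes the convergence joint in the point and the vector. *)
Lemma cvg_diff_apply (m n : nat) (T : Type) (F : set_system T) {FF : Filter F}
    (G : 'rV[R]_m -> 'rV[R]_n) x0 u0 (x u : T -> 'rV[R]_m) :
  (forall v, {for x0, continuous (fun x => 'd G x v)}) ->
  x @ F --> x0 -> u @ F --> u0 ->
  'd G (x t) (u t) @[t --> F] --> 'd G x0 u0.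
Proof.
move=> Gc xx0 uu0.
have E y w : 'd G y w = \sum_j w ord0 j *: 'd G y (delta_mx 0 j).
  by rewrite {1}(row_sum_delta w) linear_sum; apply: eq_bigr => j _; rewrite linearZ.
have -> : (fun t => 'd G (x t) (u t)) =
    (fun t => \sum_j u t ord0 j *: 'd G (x t) (delta_mx 0 j)).
  by apply/funext => t; exact: E.
rewrite [X in _ --> X]E.
apply: cvg_rsum => j _; apply: cvgZ.
  apply: (cvg_continuous_comp (h := fun M : 'rV[R]_m => M ord0 j)) uu0.
  exact: coord_continuous.
apply: (cvg_continuous_comp (h := fun y => 'd G y (delta_mx 0 j))) xx0.
exact: Gc.
Qed.
End DiffExtra.

Section Charts.
Context {R : realType}.

Definition drep (M N : manifold R) (phi : chart R M (mdim M))
    (psi : chart R N (mdim N)) (f : M -> N) (p : M)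
    : 'rV[R]_(mdim M) -> 'rV[R]_(mdim N) :=
  'd (psi \o f \o cbwd phi) (phi p).

Lemma chart_near (M : manifold R) (phi : chart R M (mdim M)) (p : M) (P : set M) :
  cdom phi p -> nbhs p P ->
  \forall y \near phi p, [/\ cdom phi (cbwd phi y), phi (cbwd phi y) = y & P (cbwd phi y)].
Proof.
move=> phip pP.
have cimp : (phi @` cdom phi) (phi p) by exists p.
have H1 : \forall y \near phi p, (phi @` cdom phi) y.
  by apply: open_nbhs_nbhs; split => //; exact: cim_open.
have H2 : \forall y \near phi p, P (cbwd phi y).
  by apply: (cbwd_continuous cimp); rewrite cfwdK.
apply: filterS2 H1 H2 => y [q phiq <-]; rewrite cfwdK // => Pq; split => //.
Qed.

Lemma C1_map_chart (M N : manifold R) (f : M -> N) phi psi (p : M) :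
  C1_map f -> atlas phi -> atlas psi -> cdom phi p -> cdom psi (f p) ->
  differentiable (psi \o f \o cbwd phi) (phi p) /\
  forall v, {for phi p, continuous (fun x => 'd (psi \o f \o cbwd phi) x v)}.
Proof.
move=> [_ fC1] aphi apsi phip psip.
have [fd fc] := fC1 _ _ aphi apsi.
have pD : (phi @` (cdom phi `&` f @^-1` cdom psi)) (phi p) by exists p.
by split; [exact: fd | move=> v; exact: fc].
Qed.

Lemma C1_map_id (M : manifold R) : C1_map (@id M).
Proof.
split; first by move=> p; exact: cvg_id.
by move=> phi psi aphi apsi; exact: (atlas_compatible aphi apsi 1).
Qed.

Lemma drep_id (M : manifold R) (phi : chart R M (mdim M)) p v :
  cdom phi p -> drep phi phi id p v = v.
Proof.
move=> phip; have idE : \forall y \near phi p, id y = (phi \o id \o cbwd phi) y.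
  by apply: filterS (chart_near phip (filterT : nbhs p setT)) => y /= [_ ->].
have [idd idv] := is_diff_id (phi p).
have [_ dE] := near_eq_diff idE idd.
by rewrite /drep dE idv.
Qed.

Lemma near_chart_comp (M N L : manifold R) (f : M -> N) (g : N -> L) phi psi chi (p : M) :
  C1_map f -> C1_map g -> atlas phi -> atlas psi -> atlas chi ->
  cdom phi p -> cdom psi (f p) -> cdom chi (g (f p)) ->
  \forall y \near phi p, [/\ cdom phi (cbwd phi y), phi (cbwd phi y) = y,
    cdom psi (f (cbwd phi y)) & cdom chi (g (f (cbwd phi y)))].
Proof.
move=> [cf _] [cg _] _ _ _ phip psip chip.
have pD : nbhs p (fun q => cdom psi (f q) /\ cdom chi (g (f q))).
  apply: filterI.
    by apply: (cf p); apply: open_nbhs_nbhs; split => //; exact: cdom_open.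
  have gD : nbhs (f p) (g @^-1` cdom chi).
    by apply: (cg (f p)); apply: open_nbhs_nbhs; split => //; exact: cdom_open.
  exact: (cf p _ gD).
by apply: filterS (chart_near phip pD) => y [? ? []].
Qed.

Lemma diff_chart_comp (M N L : manifold R) (f : M -> N) (g : N -> L) phi psi chi (p : M) :
  C1_map f -> C1_map g -> atlas phi -> atlas psi -> atlas chi ->
  cdom phi p -> cdom psi (f p) -> cdom chi (g (f p)) ->
  differentiable (chi \o (g \o f) \o cbwd phi) (phi p) /\
  forall v, drep phi chi (g \o f) p v = drep psi chi g (f p) (drep phi psi f p v).
Proof.
move=> Cf Cg aphi apsi achi phip psip chip.
have [df _] := C1_map_chart Cf aphi apsi phip psip.
have [dg _] := C1_map_chart Cg apsi achi psip chip.
have E : \forall y \near phi p, ((chi \o g \o cbwd psi) \o (psi \o f \o cbwd phi)) y =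
    (chi \o (g \o f) \o cbwd phi) y.
  apply: filterS (near_chart_comp Cf Cg aphi apsi achi phip psip chip) => y [_ _ py _] /=.
  by rewrite cfwdK.
have fpE : (psi \o f \o cbwd phi) (phi p) = psi (f p) by rewrite /= cfwdK.
have dg' : differentiable (chi \o g \o cbwd psi) ((psi \o f \o cbwd phi) (phi p)).
  by rewrite fpE.
have [d dE] := near_eq_diff E (differentiable_comp df dg').
split; first exact: d.
by move=> v; rewrite /drep dE (diff_comp df dg') [LHS]/comp fpE.
Qed.

Lemma drep_comp (M N L : manifold R) (f : M -> N) (g : N -> L) phi psi chi (p : M) v :
  C1_map f -> C1_map g -> atlas phi -> atlas psi -> atlas chi ->
  cdom phi p -> cdom psi (f p) -> cdom chi (g (f p)) ->
  drep phi chi (g \o f) p v = drep psi chi g (f p) (drep phi psi f p v).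
Proof.
by move=> Cf Cg aphi apsi achi phip psip chip; apply diff_chart_comp.
Qed.

Lemma C1_map_comp (M N L : manifold R) (f : M -> N) (g : N -> L) :
  C1_map f -> C1_map g -> C1_map (g \o f).
Proof.
move=> Cf Cg; split.
  by move=> p; apply: continuous_comp; [apply Cf | apply Cg].
move=> phi chi aphi achi; split.
  move=> _ [p [phip chip] <-].
  exact: (diff_chart_comp Cf Cg aphi (chart_at_atlas (f p)) achi phip
    (chart_at_dom (f p)) chip).1.
move=> v _ [p [phip chip] <-].
(* The middle chart is chosen for this p only: [G] below is the chain rule through it, valid near
   [phi p], which is all that continuity at [phi p] requires. *)
set psi := chart_at (f p).
have apsi : atlas psi by exact: chart_at_atlas.
have psip : cdom psi (f p) by exact: chart_at_dom.
have [df cdf] := C1_map_chart Cf aphi apsi phip psip.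
have [_ cdg] := C1_map_chart Cg apsi achi psip chip.
pose G := fun x => 'd (chi \o g \o cbwd psi) ((psi \o f \o cbwd phi) x)
   ('d (psi \o f \o cbwd phi) x v).
have E : \forall x \near phi p, G x = 'd (chi \o (g \o f) \o cbwd phi) x v.
  apply: filterS (near_chart_comp Cf Cg aphi apsi achi phip psip chip) => y [y1 y2 y3 y4].
  have := drep_comp v Cf Cg aphi apsi achi y1 y3 y4.
  by rewrite /drep y2 /G /= => ->.
have fpE : (psi \o f \o cbwd phi) (phi p) = psi (f p) by rewrite /= cfwdK.
have Gc : G x @[x --> phi p] --> G (phi p).
  apply: (cvg_diff_apply (G := chi \o g \o cbwd psi) (x := psi \o f \o cbwd phi)
      (u := fun x => 'd (psi \o f \o cbwd phi) x v)).
  - exact: nbhs_filter.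
  - by move=> w; rewrite fpE; exact: cdg.
  - exact: (differentiable_continuous df).
  - exact: cdf.
have Gc' : 'd (chi \o (g \o f) \o cbwd phi) x v @[x --> phi p] --> G (phi p).
  by exact: near_cvg_eq E Gc.
have E0 : G (phi p) = 'd (chi \o (g \o f) \o cbwd phi) (phi p) v := nbhs_singleton E.
rewrite E0 in Gc'.
exact: Gc'.
Qed.

End Charts.

(** * Tangent bundle *)

Section Tangent.
Context {R : realType}.

(* The tangent bundle, with the identification of T_p M with R^n through
   chart_at p: the product topology of this type is not the topology of TM. *)
Definition tm (M : manifold R) : Type := (M * 'rV[R]_(mdim M))%type.

Definition tv (M : manifold R) (p : M) (v : 'rV[R]_(mdim M)) : tm M := (p, v).

Definition tmap (M N : manifold R) (f : M -> N) (z : tm M) : tm N :=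
  tv (f z.1) (diff_map f z.1 z.2).

(** Inverse of [of_chart phi z.1]. Both are local representatives of the identity map, so that the
    chain rule [drep_comp] yields all coordinate changes. *)
Definition to_chart (M : manifold R) (phi : chart R M (mdim M)) (z : tm M)
    : 'rV[R]_(mdim M) := drep (chart_at z.1) phi id z.1 z.2.

Lemma diff_mapE (M N : manifold R) (f : M -> N) p v :
  diff_map f p v = drep (chart_at p) (chart_at (f p)) f p v.
Proof. by rewrite /diff_map lfunE. Qed.

Lemma of_chartE (M : manifold R) (phi : chart R M (mdim M)) p u :
  of_chart phi p u = drep phi (chart_at p) id p u.
Proof. by []. Qed.

Lemma of_chart_linear (M : manifold R) (phi : chart R M (mdim M)) p :
  linear (of_chart phi p).
Proof. by move=> k u v; rewrite /of_chart linearP. Qed.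

HB.instance Definition _ (M : manifold R) (phi : chart R M (mdim M)) p :=
  GRing.isLinear.Build R 'rV[R]_(mdim M) 'rV[R]_(mdim M) *:%R
    (of_chart phi p) (of_chart_linear phi p).

Lemma to_chartK (M : manifold R) (phi : chart R M (mdim M)) (z : tm M) :
  atlas phi -> cdom phi z.1 -> of_chart phi z.1 (to_chart phi z) = z.2.
Proof.
case: z => p v aphi phip /=.
rewrite of_chartE /to_chart /= -[in LHS](@drep_comp _ M M M id id (chart_at p)) //;
  try exact: C1_map_id; try exact: chart_at_atlas; try exact: chart_at_dom.
exact/drep_id/chart_at_dom.
Qed.

Lemma of_chartK (M : manifold R) (phi : chart R M (mdim M)) p u :
  atlas phi -> cdom phi p -> to_chart phi (tv p (of_chart phi p u)) = u.
Proof.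
move=> aphi phip.
rewrite of_chartE /to_chart /= -[in LHS](@drep_comp _ M M M id id phi) //;
  try exact: C1_map_id; try exact: chart_at_atlas; try exact: chart_at_dom.
exact/drep_id.
Qed.

Lemma tmap_id (M : manifold R) (z : tm M) : tmap id z = z.
Proof.
by case: z => p v; rewrite /tmap /= diff_mapE drep_id //; exact: chart_at_dom.
Qed.

Lemma tmap_comp (M N L : manifold R) (f : M -> N) (g : N -> L) (z : tm M) :
  C1_map f -> C1_map g -> tmap (g \o f) z = tmap g (tmap f z).
Proof.
move=> Cf Cg; case: z => p v; rewrite /tmap /= !diff_mapE.
by rewrite (@drep_comp _ M N L f g _ (chart_at (f p))) //;
  try exact: chart_at_atlas; try exact: chart_at_dom.
Qed.

Lemma to_chart_tmap (M N : manifold R) (f : M -> N) phi psi (z : tm M) :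
  C1_map f -> atlas phi -> atlas psi -> cdom phi z.1 -> cdom psi (f z.1) ->
  to_chart psi (tmap f z) = drep phi psi f z.1 (to_chart phi z).
Proof.
move=> Cf aphi apsi; case: z => p v /= phip psip.
rewrite /to_chart /tmap /= diff_mapE.
rewrite -[in LHS](@drep_comp _ M N N f id _ (chart_at (f p))) //;
  try exact: C1_map_id; try exact: chart_at_atlas; try exact: chart_at_dom.
rewrite -[in RHS](@drep_comp _ M M N id f _ phi) //;
  try exact: C1_map_id; try exact: chart_at_atlas; exact: chart_at_dom.
Qed.

(* Convergence in TM; any chart around the limit may be used in place of
   chart_at, see tcvg_chart and tcvg_of_chart. *)
Definition tcvg (M : manifold R) (T : Type) (F : set_system T) (h : T -> tm M)
    (z : tm M) : Prop :=
  (h t).1 @[t --> F] --> z.1 /\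
  to_chart (chart_at z.1) (h t) @[t --> F] --> to_chart (chart_at z.1) z.

Lemma cvg_to_chart_tmap (M N : manifold R) (f : M -> N) phi psi (T : Type)
    (F : set_system T) (h : T -> tm M) (z : tm M) : Filter F ->
  C1_map f -> atlas phi -> atlas psi -> cdom phi z.1 -> cdom psi (f z.1) ->
  (h t).1 @[t --> F] --> z.1 ->
  to_chart phi (h t) @[t --> F] --> to_chart phi z ->
  to_chart psi (tmap f (h t)) @[t --> F] --> to_chart psi (tmap f z).
Proof.
move=> FF Cf aphi apsi phip psip hz1 hz2.
have [df cdf] := C1_map_chart Cf aphi apsi phip psip.
have D : \forall t \near F, cdom phi (h t).1 /\ cdom psi (f (h t).1).
  apply: filterI.
    by apply: hz1; apply: open_nbhs_nbhs; split => //; exact: cdom_open.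
  have fD : nbhs z.1 (f @^-1` cdom psi).
    by apply: (Cf.1 z.1); apply: open_nbhs_nbhs; split => //; exact: cdom_open.
  exact: (hz1 _ fD).
rewrite (to_chart_tmap Cf aphi apsi) //.
apply: (@near_cvg_eq _ _ _ _ (fun t => drep phi psi f (h t).1 (to_chart phi (h t)))).
  by apply: filterS D => t [? ?]; rewrite (to_chart_tmap Cf aphi apsi).
apply: cvg_diff_apply => //.
by apply: cvg_continuous_comp hz1; exact: cfwd_continuous.
Qed.

Lemma tcvg_chart (M : manifold R) phi (T : Type) (F : set_system T)
    (h : T -> tm M) (z : tm M) : Filter F -> atlas phi -> cdom phi z.1 ->
  tcvg F h z -> to_chart phi (h t) @[t --> F] --> to_chart phi z.
Proof.
move=> FF aphi phip [h1 h2].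
have := @cvg_to_chart_tmap M M id _ phi T F h z FF (C1_map_id M)
  (chart_at_atlas z.1) aphi (chart_at_dom z.1) phip h1 h2.
rewrite tmap_id; have -> // : (fun t => to_chart phi (tmap id (h t))) =
  (fun t => to_chart phi (h t)) by apply/funext => t; rewrite tmap_id.
Qed.

Lemma tcvg_tmap (M N : manifold R) (f : M -> N) (T : Type)
    (F : set_system T) (h : T -> tm M) (z : tm M) : Filter F ->
  C1_map f -> tcvg F h z -> tcvg F (tmap f \o h) (tmap f z).
Proof.
move=> FF Cf [h1 h2]; split.
  by apply: cvg_continuous_comp h1; exact: Cf.1.
exact: (cvg_to_chart_tmap FF Cf (chart_at_atlas z.1) (chart_at_atlas (f z.1))
  (chart_at_dom z.1) (chart_at_dom (f z.1)) h1 h2).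
Qed.

Lemma tcvg_of_chart (M : manifold R) phi (T : Type) (F : set_system T)
    (P : T -> M) (U : T -> 'rV[R]_(mdim M)) p u : Filter F ->
  atlas phi -> cdom phi p -> P @ F --> p -> U @ F --> u ->
  tcvg F (fun t => (tv (P t) (of_chart phi (P t) (U t)))) (tv p (of_chart phi p u)).
Proof.
move=> FF aphi phip Pp Uu; split => //=.
have := @cvg_to_chart_tmap M M id phi (chart_at p) T F
  (fun t => (tv (P t) (of_chart phi (P t) (U t)))) (tv p (of_chart phi p u))
  FF (C1_map_id M) aphi (chart_at_atlas p) phip (chart_at_dom p) Pp.
rewrite tmap_id of_chartK //.
have -> : (fun t => to_chart (chart_at p) (tmap id (tv (P t) (of_chart phi (P t) (U t))))) =
    (fun t => to_chart (chart_at p) (tv (P t) (of_chart phi (P t) (U t)))).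
  by apply/funext => t; rewrite tmap_id.
move=> H; apply: H; apply: near_cvg_eq Uu.
have : nbhs p (cdom phi) by apply: open_nbhs_nbhs; split => //; exact: cdom_open.
move=> pD; have {}pD : \forall t \near F, cdom phi (P t) := Pp _ pD.
by apply: filterS pD => t phit; rewrite of_chartK.
Qed.

Lemma tcvg_ext (M : manifold R) (T : Type) (F : set_system T) (h k : T -> tm M) z :
  Filter F -> (\forall t \near F, h t = k t) -> tcvg F h z -> tcvg F k z.
Proof.
move=> FF hk [h1 h2]; split; [apply: near_cvg_eq h1|apply: near_cvg_eq h2];
  by apply: filterS hk => t ->.
Qed.

End Tangent.

(** * Fibrewise seminorms *)

Section RiemannianNorm.
Context {R : realType}.

Definition nrm (M : riemannian R) (z : tm M) : R := rnorm z.1 z.2.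

(** Stated with arbitrary filters through [tcvg], because the topology carried by the type [tm M] is
    not that of TM. *)
Definition tcont (M : manifold R) (N : tm M -> R) : Prop :=
  forall (T : Type) (F : set_system T) (h : T -> tm M) (z : tm M), Filter F ->
    tcvg F h z -> N (h t) @[t --> F] --> N z.

Definition tmcont (M N : manifold R) (g : tm M -> tm N) : Prop :=
  forall (T : Type) (F : set_system T) (h : T -> tm M) (z : tm M), Filter F ->
    tcvg F h z -> tcvg F (g \o h) (g z).

Record fseminorm (M : manifold R) (N : tm M -> R) : Prop := FSeminorm {
  fsn_ge0 : forall z, 0 <= N z;
  fsnD : forall p u v, N (tv p (u + v)) <= N (tv p u) + N (tv p v);
  fsnZ : forall p k u, N (tv p (k *: u)) = `|k| * N (tv p u) }.

Lemma fsn0 (M : manifold R) (N : tm M -> R) : fseminorm N -> forall p, N (tv p 0) = 0.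
Proof. by move=> sN p; rewrite -[X in tv p X](scale0r 0) (fsnZ sN) normr0 mul0r. Qed.

Lemma fsnN (M : manifold R) (N : tm M -> R) : fseminorm N ->
  forall p u, N (tv p (- u)) = N (tv p u).
Proof. by move=> sN p u; rewrite -scaleN1r (fsnZ sN) normrN1 mul1r. Qed.

Lemma fsnB (M : manifold R) (N : tm M -> R) : fseminorm N ->
  forall p u v, N (tv p (u - v)) <= N (tv p u) + N (tv p v).
Proof. by move=> sN p u v; rewrite (le_trans (fsnD sN _ _ _)) // (fsnN sN). Qed.

Section Metric.
Context (M : riemannian R) (p : M).

Lemma metricDl u v w : metric p (u + v) w = metric p u w + metric p v w.
Proof. by have := metric_linear p w 1 u v; rewrite scale1r /= mul1r. Qed.
Lemma metricZl k u w : metric p (k *: u) w = k * metric p u w.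
Proof.
have /= := metric_linear p w k u 0; rewrite addr0 => ->.
have /= := metric_linear p w 0 0 0; rewrite scale0r mul0r !add0r => H.
suff -> : metric p 0 w = 0 by rewrite addr0.
have := metric_linear p w 1 0 0; rewrite scale1r addr0 /= mul1r.
by move/esym/eqP; rewrite -subr_eq0 addrK => /eqP.
Qed.
Lemma metricDr u v w : metric p w (u + v) = metric p w u + metric p w v.
Proof. by rewrite Defs.metric_sym metricDl !(Defs.metric_sym p w). Qed.
Lemma metricZr k u w : metric p w (k *: u) = k * metric p w u.
Proof. by rewrite Defs.metric_sym metricZl (Defs.metric_sym p w). Qed.
Lemma metric0l w : metric p 0 w = 0.
Proof. by rewrite -[X in metric p X](scale0r 0) metricZl mul0r. Qed.
Lemma metric0r w : metric p w 0 = 0.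
Proof. by rewrite Defs.metric_sym metric0l. Qed.
Lemma metric_ge0 u : 0 <= metric p u u.
Proof.
have [->|u0] := eqVneq u 0; last exact/ltW/metric_pos.
by rewrite metric0l.
Qed.

Lemma metric_sum (n : nat) (c d : 'I_n -> R) (e : 'I_n -> 'rV[R]_(mdim M)) :
  metric p (\sum_i c i *: e i) (\sum_i d i *: e i) =
  \sum_i \sum_j c i * (d j * metric p (e i) (e j)).
Proof.
rewrite (big_morph (fun u => metric p u (\sum_i d i *: e i)) (fun u v =>
  metricDl u v _) (metric0l _)).
apply: eq_bigr => i _; rewrite metricZl.
rewrite (big_morph (metric p (e i)) (fun u v => metricDr u v _) (metric0r _)).
by rewrite mulr_sumr; apply: eq_bigr => j _; rewrite metricZr.
Qed.

Lemma metric_CS u v : metric p u v ^+ 2 <= metric p u u * metric p v v.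
Proof.
have [->|v0] := eqVneq v 0.
  by rewrite !metric0r mulr0 expr0n.
have b0 := metric_pos p v0; set b := metric p v v in b0 *.
set c := metric p u v; set a := metric p u u.
(* The square length of this vector is b (a b - c^2). *)
have := metric_ge0 (b *: u + (- c) *: v).
rewrite !(metricDl, metricDr, metricZl, metricZr) (Defs.metric_sym p v u).
rewrite -/a -/b -/c => H.
have : 0 <= b * (a * b - c ^+ 2) by apply: le_trans H _; rewrite le_eqVlt; apply/orP;
left; apply/eqP; ring.
by rewrite pmulr_rge0 // subr_ge0.
Qed.

Lemma rnormD u v : rnorm p (u + v) <= rnorm p u + rnorm p v.
Proof.
have uv0 : 0 <= rnorm p u + rnorm p v by rewrite addr_ge0 // sqrtr_ge0.
rewrite -[leRHS](ger0_norm uv0) -sqrtr_sqr /rnorm ler_sqrt ?sqr_ge0 //.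
rewrite sqrrD !sqr_sqrtr ?metric_ge0 // !(metricDl, metricDr) (Defs.metric_sym p v u).
set s := Num.sqrt _ * Num.sqrt _.
suff : metric p u v <= s by move=> ?; rewrite mulr2n; lra.
apply: le_trans (ler_norm _) _.
rewrite -sqrtr_sqr /s -sqrtrM ?metric_ge0 // ler_sqrt ?metric_CS //.
by rewrite mulr_ge0 ?metric_ge0.
Qed.

Lemma rnormZ k u : rnorm p (k *: u) = `|k| * rnorm p u.
Proof.
rewrite /rnorm metricZl metricZr mulrA -expr2 sqrtrM ?sqr_ge0 //.
by rewrite sqrtr_sqr.
Qed.

Lemma rnorm_gt0 u : u != 0 -> 0 < rnorm p u.
Proof. by move=> u0; rewrite sqrtr_gt0 metric_pos. Qed.

End Metric.

Lemma nrm_seminorm (M : riemannian R) : fseminorm (@nrm M).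
Proof.
split=> [z|p u v|p k u]; [exact: sqrtr_ge0|exact: rnormD|exact: rnormZ].
Qed.

Lemma nrm_cont (M : riemannian R) : tcont (@nrm M).
Proof.
move=> T F h z FF [h1 h2].
have aphi := chart_at_atlas z.1; have phip := chart_at_dom z.1.
set phi := chart_at z.1 in aphi phip h2.
(* Gram matrix of the coordinate frame of phi; [metric_smooth] at order 0 gives the continuity of
   its entries. *)
pose m i j x : R := metric (cbwd phi x) (of_chart phi (cbwd phi x) (delta_mx 0 i))
  (of_chart phi (cbwd phi x) (delta_mx 0 j)).
pose g (x u : 'rV[R]_(mdim M)) := Num.sqrt (\sum_i \sum_j u ord0 i * (u ord0 j * m i j x)).
have E (y : tm M) : cdom phi y.1 -> nrm y = g (phi y.1) (to_chart phi y).
  move=> phiy; rewrite /nrm /rnorm -{1 2}(to_chartK aphi phiy) /g; congr (Num.sqrt _).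
  rewrite {1 2}(row_sum_delta (to_chart phi y)) !linear_sum /=.
  under eq_bigr do rewrite linearZ /=.
  rewrite metric_sum; apply: eq_bigr => i _; apply: eq_bigr => j _.
  by rewrite /m cfwdK.
have D : \forall t \near F, cdom phi (h t).1.
  by apply: h1; apply: open_nbhs_nbhs; split => //; exact: cdom_open.
rewrite E //.
apply: (@near_cvg_eq _ _ _ _ (fun t => g (phi (h t).1) (to_chart phi (h t)))).
  by apply: filterS D => t /E.
have hx : phi (h t).1 @[t --> F] --> phi z.1.
  by apply: cvg_continuous_comp h1; exact: cfwd_continuous.
apply: (cvg_continuous_comp (h := Num.sqrt)); first exact: sqrt_continuous.
have hu i : to_chart phi (h t) ord0 i @[t --> F] --> to_chart phi z ord0 i.
  apply: (cvg_continuous_comp (h := fun M : 'rV[R]_(mdim _) => M ord0 i)) h2.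
  exact: coord_continuous.
apply: cvg_rsum => i _; apply: cvg_rsum => j _.
apply: cvgM (hu i) _; apply: cvgM (hu j) _.
apply: (cvg_continuous_comp (h := m i j)) hx.
by apply: (metric_smooth aphi (delta_mx 0 i) (delta_mx 0 j) 0); exists z.1.
Qed.

End RiemannianNorm.

(** * Continuity of the projections *)

Section Projection.
Context {R : realType}.

Lemma free_unitmx (m : nat) (X : 'rV[R]_m -> 'rV[R]_m) (b : 'I_m -> 'rV[R]_m) :
  linear X -> free [seq X (b i) | i : 'I_m] ->
  \matrix_(i < m) b i \in unitmx.
Proof.
move=> Xl Xf; rewrite -row_free_unit; apply: inj_row_free => c.
pose XL := linfun (HB.pack_for {linear 'rV[R]_m -> 'rV[R]_m} X (GRing.isLinear.Build
  _ _ _ _ X Xl)).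
have XLE x : XL x = X x by rewrite lfunE.
move=> /(congr1 XL); rewrite linear0 mulmx_sum_row linear_sum /= => c0.
have sz : size [seq X (b i) | i : 'I_m] == m by rewrite size_map size_enum_ord.
have /freeP := (Xf : free (Tuple sz)).
move=> /(_ (c ord0)) H; apply/rowP => i; rewrite mxE; apply: H => {i}.
rewrite -[RHS]c0; apply: eq_bigr => i _; rewrite linearZ /= rowK XLE; congr (_ *: _).
by rewrite (nth_map i) ?nth_ord_enum // size_enum_ord.
Qed.

Lemma cvg_rprod (I : Type) (r : seq I) (T : Type) (F : set_system T)
    {FF : Filter F} (f : I -> T -> R) (l : I -> R) :
  (forall i, f i t @[t --> F] --> l i) ->
  \prod_(i <- r) f i t @[t --> F] --> \prod_(i <- r) l i.
Proof.
move=> fl; elim: r => [|i r IH].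
  by rewrite big_nil; under eq_fun do rewrite big_nil; exact: cvg_cst.
by rewrite big_cons; under eq_fun do rewrite big_cons; exact: cvgM.
Qed.

Lemma cvg_det (m : nat) (T : Type) (F : set_system T) {FF : Filter F}
    (A : T -> 'M[R]_m) (B : 'M[R]_m) :
  (forall i j, A t i j @[t --> F] --> B i j) -> \det (A t) @[t --> F] --> \det B.
Proof.
move=> AB; rewrite /determinant; apply: cvg_rsum => s _.
apply: cvgM; first exact: cvg_cst.
by apply: cvg_rprod => i; exact: AB.
Qed.

(** By Cramer's formula the entries of the inverse are polynomials in the entries divided by the
    determinant, whose limit is nonzero. *)
Lemma cvg_invmx (m : nat) (T : Type) (F : set_system T) {FF : Filter F}
    (A : T -> 'M[R]_m) (B : 'M[R]_m) i j :
  (forall i j, A t i j @[t --> F] --> B i j) -> B \in unitmx ->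
  (\forall t \near F, A t \in unitmx) ->
  invmx (A t) i j @[t --> F] --> invmx B i j.
Proof.
move=> AB uB uA.
have E C : C \in unitmx -> invmx C i j = (\det C)^-1 * cofactor C j i.
  by move=> uC; rewrite /invmx uC !mxE.
rewrite E //; apply: (@near_cvg_eq _ _ _ _ (fun t => (\det (A t))^-1 * cofactor (A t) j i)).
  by apply: filterS uA => t /E.
apply: cvgM.
  apply: cvgV; last exact: cvg_det.
  by move: uB; rewrite unitmxE unitfE.
apply: cvgM; first exact: cvg_cst.
by apply: cvg_det => k l; rewrite !mxE; under eq_fun do rewrite !mxE; exact: AB.
Qed.

Definition tproj (M : manifold R) (E E' : M -> {vspace 'rV[R]_(mdim M)}) (z : tm M) :
  tm M :=
  tv z.1 (daddv_pi (E z.1) (E' z.1) z.2).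

Lemma cvg_rV (m : nat) (T : Type) (F : set_system T) {FF : Filter F}
    (u : T -> 'rV[R]_m) (v : 'rV[R]_m) :
  u @ F --> v -> forall i, u t ord0 i @[t --> F] --> v ord0 i.
Proof.
move=> uv i; apply: (cvg_continuous_comp (h := fun M : 'rV[R]_m => M ord0 i)) uv.
exact: coord_continuous.
Qed.

(** In one chart the two local frames together are the rows of an invertible matrix [B p]. The
    projection reads the coordinates [u *m invmx (B p)] and keeps the first k of them, an expression
    continuous in p and u. *)
Lemma proj_cont (M : manifold R) (E E' : M -> {vspace 'rV[R]_(mdim M)}) :
  continuous_subbundle E -> continuous_subbundle E' ->
  (forall p, (E p + E' p = fullv)%VS) -> (forall p, (E p :&: E' p = 0)%VS) ->
  tmcont (tproj E E').
Proof.
move=> cE cE' EE' E0 T F h z FF hz; split; first exact: hz.1.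
have [h1 h2] := hz.
have aphi := chart_at_atlas z.1; have phip := chart_at_dom z.1.
have [k [w wE]] := cE z.1; have [l [w' wE']] := cE' z.1.
rewrite [(tproj E E' z).1]/=.
set phi := chart_at z.1 in wE wE' aphi phip h2 *.
set m := mdim M in w wE w' wE' *.
pose S : seq (M -> 'rV[R]_m) := [seq w j | j : 'I_k] ++ [seq w' j | j : 'I_l].
(* The default field 0 is not reached for i < m where the two frames are bases, since then k + l =
   m. *)
pose om (i : nat) : M -> 'rV[R]_m := nth (fun=> 0) S i.
pose B p : 'M[R]_m := \matrix_(i < m) om i p.
pose Pi p (u : 'rV[R]_m) : 'rV[R]_m :=
  \sum_(i < m) (if (i < k)%N then (u *m invmx (B p)) ord0 i else 0) *: om i p.
have szk : size [seq w j | j : 'I_k] = k by rewrite size_map size_enum_ord.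
have szl : size [seq w' j | j : 'I_l] = l by rewrite size_map size_enum_ord.
have om_cont i : {for z.1, continuous (om i)}.
  rewrite /om /S nth_cat szk; case: ltnP => ik.
    rewrite (nth_map (Ordinal ik)) ?size_enum_ord //.
    by have [+ _] := nbhs_singleton wE; apply.
  have [il|il] := ltnP (i - k)%N l.
    rewrite (nth_map (Ordinal il)) ?size_enum_ord //.
    by have [+ _] := nbhs_singleton wE'; apply.
  by rewrite nth_default ?szl //; exact: cvg_cst.
have key p : cdom phi p ->
    basis_of (E p) [seq of_chart phi p (w j p) | j : 'I_k] ->
    basis_of (E' p) [seq of_chart phi p (w' j p) | j : 'I_l] ->
    B p \in unitmx /\ forall u, daddv_pi (E p) (E' p) (of_chart phi p u) = of_chart
      phi p (Pi p u).
  move=> phip' b1 b2.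
  have SE : [seq of_chart phi p (g p) | g <- S] =
    [seq of_chart phi p (w j p) | j : 'I_k] ++ [seq of_chart phi p (w' j p) | j : 'I_l].
    by rewrite /S map_cat /image_mem -!map_comp.
  have klm : (k + l)%N = m.
    have := dimv_disjoint_sum (E0 p); rewrite EE' dimvf (size_basis b1) (size_basis b2).
    by rewrite !card_ord /dim /= mul1n => /esym.
  have szS : size S = m by rewrite size_cat szk szl klm.
  have fS : free [seq of_chart phi p (g p) | g <- S].
    rewrite SE cat_free (basis_free b1) (basis_free b2) /=.
    by apply/directv_addP; rewrite (span_basis b1) (span_basis b2).
  have SE' : [seq of_chart phi p (g p) | g <- S] = [seq of_chart phi p (om i p) | i : 'I_m].
    apply: (@eq_from_nth _ 0); first by rewrite size_map szS size_image card_ord.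
    move=> i; rewrite size_map => iS; rewrite (nth_map (fun=> 0)) //.
    have im : (i < m)%N by rewrite -szS.
    rewrite (nth_map (Ordinal im)) ?size_enum_ord //.
    by rewrite [X in of_chart _ _ (om X _)](nth_enum_ord).
  have uB : B p \in unitmx.
    by apply: (@free_unitmx _ (of_chart phi p)); [exact: of_chart_linear|rewrite -SE'].
  split => // u.
  set c := u *m invmx (B p).
  have uE : u = \sum_(i < m) c ord0 i *: om i p.
    by rewrite -[LHS](mulmxKV uB) mulmx_sum_row; apply: eq_bigr => i _; rewrite rowK.
  have omE i : (i < k)%N -> of_chart phi p (om i p) \in E p.
    move=> ik; apply: (basis_mem b1); rewrite /om /S nth_cat szk ik.
    rewrite (nth_map (Ordinal ik)) ?size_enum_ord //.
    by apply: (map_f (fun j => of_chart phi p (w j p))); rewrite mem_enum.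
  have omE' i : (k <= i)%N -> of_chart phi p (om i p) \in E' p.
    move=> ik; rewrite /om /S nth_cat szk ltnNge ik /=.
    have [il|il] := ltnP (i - k)%N l; last by rewrite nth_default ?szl // linear0 mem0v.
    apply: (basis_mem b2); rewrite (nth_map (Ordinal il)) ?size_enum_ord //.
    by apply: (map_f (fun j => of_chart phi p (w' j p))); rewrite mem_enum.
  have uPi : u = Pi p u + (u - Pi p u) by rewrite addrC subrK.
  rewrite {1}uPi linearD /= linearD /=.
  rewrite (daddv_pi_id (E0 p)); last first.
    rewrite linear_sum memv_suml // => i _; rewrite linearZ /=.
    by case: ifP => [/omE|_]; [exact: memvZ|rewrite scale0r mem0v].
  rewrite -[RHS]addr0; congr (_ + _).
  have : of_chart phi p (u - Pi p u) \in E' p.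
    rewrite {1}uE /Pi -sumrB linear_sum memv_suml // => i _.
    rewrite -scalerBl linearZ /=; case: ltnP => ik; first by rewrite subrr scale0r mem0v.
    by rewrite memvZ // omE'.
  set x := of_chart _ _ _ => xE'.
  (* The two projections of x add up to x, and the one onto E' already equals x; hence the one onto
     E vanishes. *)
  have cap' : (E' p :&: E p = 0)%VS by rewrite capvC.
  have := daddv_pi_add (E0 p) (memv_add (mem0v (E p)) xE'); rewrite add0r.
  by rewrite (daddv_pi_id cap' xE') => /eqP; rewrite -subr_eq0 addrK => /eqP.
have D : \forall p \near z.1, [/\ cdom phi p, B p \in unitmx &
    forall u, daddv_pi (E p) (E' p) (of_chart phi p u) = of_chart phi p (Pi p u)].
  have pD : nbhs z.1 (cdom phi) by apply: open_nbhs_nbhs; split => //; exact: cdom_open.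
  apply: filterS3 pD wE wE' => p phip' [_ b1] [_ b2].
  by have [] := key p phip' b1 b2.
have DF : \forall t \near F, [/\ cdom phi (h t).1, B (h t).1 \in unitmx &
    forall u, daddv_pi (E (h t).1) (E' (h t).1) (of_chart phi (h t).1 u) = of_chart
      phi (h t).1 (Pi (h t).1 u)].
  exact: (h1 _ D).
have PE (y : tm M) : cdom phi y.1 -> (forall u,
  daddv_pi (E y.1) (E' y.1) (of_chart phi y.1 u) = of_chart phi y.1 (Pi y.1 u)) ->
  to_chart phi (tproj E E' y) = Pi y.1 (to_chart phi y).
  move=> phiy H; rewrite /tproj -{1}(to_chartK aphi phiy) H of_chartK //.
have [_ uB H0] := nbhs_singleton D.
rewrite PE //.
apply: (@near_cvg_eq _ _ _ _ (fun t => Pi (h t).1 (to_chart phi (h t)))).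
  by apply: filterS DF => t [? ? ?]; rewrite /= PE.
have hom i : om i (h t).1 @[t --> F] --> om i z.1.
  by apply: cvg_continuous_comp h1; exact: om_cont.
apply: cvg_rsum => i _; apply: cvgZ; last exact: hom.
case: ifP => _; last exact: cvg_cst.
rewrite mxE; under eq_fun do rewrite mxE.
apply: cvg_rsum => j _; apply: cvgM; first exact: cvg_rV.
apply: cvg_invmx => //.
  by move=> i' j'; rewrite mxE; under eq_fun do rewrite mxE; apply: cvg_rV; exact: hom.
by apply: filterS DF => t [].
Qed.

End Projection.

(** * Uniform closeness of differentials *)

Section Closeness.
Context {R : realType}.

Lemma compact_sphere (m : nat) : compact [set u : 'rV[R]_m | `|u| = 1].
Proof.
apply: bounded_closed_compact.
  by exists 1; split => // x x1 u /= ->; exact: ltW.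
apply: (@closed_comp _ _ (fun u : 'rV[R]_m => `|u|) [set 1]).
  by move=> u _; exact: norm_continuous.
exact: closed_eq.
Qed.

Lemma tmapZ (M N : manifold R) (f : M -> N) p k v :
  tmap f (tv p (k *: v)) = tv (f p) (k *: diff_map f p v).
Proof. by rewrite /tmap /= linearZ. Qed.

Lemma fsn_tmapZ (M N : manifold R) (f : M -> N) (Nf : tm N -> R) :
  fseminorm Nf -> forall p k v, Nf (tmap f (tv p (k *: v))) = `|k| * Nf (tmap f (tv p v)).
Proof. by move=> sN p k v; rewrite tmapZ; exact: (fsnZ sN (f p) k). Qed.

Lemma tmap0 (M N : manifold R) (f : M -> N) p : tmap f (tv p 0) = tv (f p) 0.
Proof. by rewrite -[X in tv p X](scale0r 0) tmapZ scale0r. Qed.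

(** The pair (q, w) stands for the coordinates of Dg z, kept arbitrary so that the threshold e is
    found before any g. Compactness of the unit sphere makes e uniform in u. *)
Lemma tangent_tube (M N : riemannian R) (f : M -> N) (Nf : tm N -> R) p0 (delta : R) :
  C1_map f -> tcont Nf -> 0 < delta ->
  let phi := chart_at p0 in let psi := chart_at (f p0) in
  \forall p \near p0 & e \near 0^'+,
  [set u | `|u| = 1] `<=` [set u | forall q w, cdom psi q ->
    `|psi (f p) - psi q| < e -> `|drep phi psi f p u - w| < e ->
    `|Nf (tmap f (tv p (of_chart phi p u))) - Nf (tv q (of_chart psi q w))|
      < delta * nrm (tv p (of_chart phi p u))].
Proof.
move=> Cf cN d0 phi psi.
have aphi : atlas phi := chart_at_atlas p0.
have apsi : atlas psi := chart_at_atlas (f p0).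
have phip : cdom phi p0 := chart_at_dom p0.
have psip : cdom psi (f p0) := chart_at_dom (f p0).
pose P (pe : M * R) (u : 'rV[R]_(mdim M)) := forall q w, cdom psi q ->
    `|psi (f pe.1) - psi q| < pe.2 -> `|drep phi psi f pe.1 u - w| < pe.2 ->
    `|Nf (tmap f (tv pe.1 (of_chart phi pe.1 u))) - Nf (tv q (of_chart psi q w))|
      < delta * nrm (tv pe.1 (of_chart phi pe.1 u)).
have := (compact_near_coveringP _).1 (@compact_sphere (mdim M)).
move=> /(_ _ (filter_prod (nbhs p0) (0 : R)^'+) P) H.
have [|A [A1 A2] AP] := H _ _; last first.
  by exists A => // -[p e] /= /(AP (p, e)).
move=> u0 u01.
pose z0 : tm M := tv p0 (of_chart phi p0 u0).
have nz0 : 0 < nrm z0.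
  apply: rnorm_gt0; apply/eqP; rewrite /z0 /= => u00.
  have := of_chartK u0 aphi phip; rewrite u00 => u02.
  move: u01; rewrite /= -u02 /to_chart /drep linear0 normr0 => /eqP.
  by rewrite eq_sym oner_eq0.
pose FF : set_system (M * 'rV[R]_(mdim M)) := filter_prod (nbhs p0) (nbhs u0).
pose h (pu : M * 'rV[R]_(mdim M)) : tm M := (pu.1, of_chart phi pu.1 pu.2).
have hz : tcvg FF h z0.
  apply: (tcvg_of_chart (P := fst) (U := snd)) => //; [exact: cvg_fst|exact: cvg_snd].
have FFF : Filter FF by exact: filter_prod_filter.
have fhz := tcvg_tmap FFF Cf hz.
have h3 := @nrm_cont _ M _ FF h z0 FFF hz.
have h4 := cN _ FF _ _ FFF fhz.
have h5 := tcvg_chart (z := tmap f z0) FFF apsi psip fhz.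
have h6 : psi (f x.1) @[x --> FF] --> psi (f p0).
  apply: (cvg_continuous_comp (h := psi)); first exact: cfwd_continuous.
  apply: (cvg_continuous_comp (h := f)); first exact: Cf.1.
  exact: cvg_fst.
set c0 := Nf (tmap f z0) in h4.
set w0 := to_chart psi (tmap f z0) in h5.
(* Two errors eta add up to delta |z0| / 2, which is below delta |z| because |z| > |z0| / 2 for z
   near z0. *)
pose eta := delta * nrm z0 / 4.
have eta0 : 0 < eta by rewrite /eta divr_gt0 // mulr_gt0.
pose G (yw : 'rV[R]_(mdim N) * 'rV[R]_(mdim N)) : tm N :=
  tv (cbwd psi yw.1) (of_chart psi (cbwd psi yw.1) yw.2).
have y0E : cbwd psi (psi (f p0)) = f p0 by rewrite cfwdK.
pose GG := filter_prod (nbhs (psi (f p0))) (nbhs w0).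
have GGF : Filter GG by exact: filter_prod_filter.
have cG : tcvg GG G (tmap f z0).
  have -> : tmap f z0 = tv (f p0) (of_chart psi (f p0) w0).
    by rewrite /w0 (to_chartK (z := tmap f z0)).
  apply: (tcvg_of_chart (P := cbwd psi \o fst) (U := snd)) => //; last exact: cvg_snd.
  rewrite -[X in _ --> X]y0E.
  apply: (cvg_continuous_comp (h := cbwd psi)); last exact: cvg_fst.
  by apply: cbwd_continuous; exists (f p0).
have := cN _ GG _ _ GGF cG; rewrite -/c0 => cG'.
move/cvgrPdist_lt: cG' => /(_ _ eta0) [[Y W] /= [yY wW] YW].
have [r1 /= r10 r1Y] := (nbhs_ballP _ _).1 yY.
have [r2 /= r20 r2W] := (nbhs_ballP _ _).1 wW.
pose r := Num.min r1 r2.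
have r0 : 0 < r by rewrite lt_min r10.
have r20' : 0 < r / 2 by rewrite divr_gt0.
have near1 : \forall x \near FF, [/\ `|psi (f p0) - psi (f x.1)| < r / 2,
   `|w0 - to_chart psi (tmap f (h x))| < r / 2,
   `|c0 - Nf (tmap f (h x))| < eta & nrm z0 / 2 < nrm (h x)].
  move/cvgrPdist_lt: h6 => /(_ _ r20') h6.
  move/cvgrPdist_lt: h5 => /(_ _ r20') h5.
  move/cvgrPdist_lt: h4 => /(_ _ eta0) h4.
  have h3' : \forall t \near FF, nrm z0 / 2 < nrm (h t).
    have n0 : 0 < nrm z0 / 2 by rewrite divr_gt0.
    move/cvgrPdist_lt: h3 => /(_ _ n0); apply: filterS => t.
    by rewrite ltr_distlC => /andP[+ _]; rewrite {1}(splitr (nrm z0)) addrK.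
  near=> x; split; near: x; assumption.
have phiD : nbhs p0 (fun p => cdom phi p /\ cdom psi (f p)).
  apply: filterI; first by apply: open_nbhs_nbhs; split => //; exact: cdom_open.
  by apply: (Cf.1 p0); apply: open_nbhs_nbhs; split => //; exact: cdom_open.
case: near1 => -[X U] /= [pX uU] XU.
exists (U, [set pe | (X pe.1 /\ (cdom phi pe.1 /\ cdom psi (f pe.1))) /\ pe.2 < r /
  2]) => /=.
  split => //.
  exists ([set p | X p /\ (cdom phi p /\ cdom psi (f p))], [set e | e < r / 2]) => //=.
  split; first exact: filterI.
  by exists (r / 2) => //= e /=; rewrite sub0r normrN => /ltr_normlW.
move=> [u [p e]] /= [Uu [[Xp [phip' psip']] er]] q w psiq fq dw.
have [/= n1 n2 n3 n4] := XU (p, u) (conj Xp Uu).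
have n2' : `|w0 - drep phi psi f p u| < r / 2.
  by move: n2; rewrite (to_chart_tmap Cf aphi apsi) //= of_chartK.
have yq : `|psi (f p0) - psi q| < r.
  rewrite -(subrKA (psi (f p))) (splitr r); apply: le_lt_trans (ler_normD _ _) _.
  by rewrite ltrD // (lt_trans fq).
have wq : `|w0 - w| < r.
  rewrite -(subrKA (drep phi psi f p u)) (splitr r); apply: le_lt_trans (ler_normD _ _) _.
  by rewrite ltrD // (lt_trans dw).
have := YW (psi q, w); rewrite /G /= cfwdK // => /(_ _)/wrap[].
  split; [apply: r1Y|apply: r2W]; rewrite -ball_normE /=.
    by apply: lt_le_trans yq _; rewrite ge_min lexx.
  by apply: lt_le_trans wq _; rewrite ge_min lexx orbT.
move=> n5; rewrite -(subrKA c0); apply: le_lt_trans (ler_normD _ _) _.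
rewrite distrC; apply: lt_trans (ltrD n3 n5) _.
have := n4; rewrite /h /= => n4'.
have -> : eta + eta = delta * (nrm z0 / 2) by rewrite /eta; field.
by rewrite ltr_pM2l.
Unshelve. all: by end_near. Qed.

Lemma homogeneous_close (a b c a' b' c' k delta : R) :
  a = `|k| * a' -> b = `|k| * b' -> c = `|k| * c' ->
  `|a' - b'| <= delta * c' -> `|a - b| <= delta * c.
Proof.
by move=> -> -> ->; rewrite -mulrBr normrM normr_id mulrCA; exact: ler_wpM2l.
Qed.

(* The finite subcover of the compact M is replaced by a near_covering argument
   with respect to the filter of d-neighbourhoods of f. *)
Lemma C1_close (M N : riemannian R) (f : diffeo M N) (Nf : tm N -> R)
    (d : diffeo M N -> diffeo M N -> R) (delta : R) :
  compact [set: M] -> C1_metric d -> tcont Nf -> fseminorm Nf -> 0 < delta ->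
  exists2 eps, 0 < eps & forall g : diffeo M N, d f g < eps ->
    forall z, `|Nf (tmap f z) - Nf (tmap g z)| <= delta * nrm z.
Proof.
move=> cM [_ dtop] cN sN d0.
have Cf : C1_map f := dfun_C1 f.
pose FF : set_system (diffeo M N) :=
  filter_from [set e : R | 0 < e] (fun e => [set g | d f g < e]).
have FFF : Filter FF.
  apply: filter_from_filter; first by exists 1; exact: ltr01.
  move=> i j i0 j0; exists (Num.min i j); first by rewrite /= lt_min i0.
  by move=> g /=; rewrite lt_min => /andP[].
pose P (g : diffeo M N) (p : M) := forall v,
  `|Nf (tmap f (tv p v)) - Nf (tmap g (tv p v))| <= delta * nrm (tv p v).
have [|eps eps0 H] := (compact_near_coveringP _).1 cM _ FF P FFF; last first.
  by exists eps => // g /H gP [p v]; exact: gP.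
move=> p0 _.
have [[A E] /= [pA eE] AE] := tangent_tube p0 Cf cN d0.
set phi := chart_at p0 in AE; set psi := chart_at (f p0) in AE.
have aphi : atlas phi := chart_at_atlas p0.
have apsi : atlas psi := chart_at_atlas (f p0).
have phip : cdom phi p0 := chart_at_dom p0.
have psip : cdom psi (f p0) := chart_at_dom (f p0).
have [e0 /= e00 e0E] := eE.
have e20 : 0 < e0 / 2 by rewrite divr_gt0.
have Ee : E (e0 / 2).
  apply: e0E => //=; rewrite sub0r normrN ger0_norm ?ltW //.
  by rewrite ltr_pdivrMr // ltr_pMr // ltr1n.
have pA' : nbhs p0 (A `&` [set p | cdom phi p /\ cdom psi (f p)]).
  apply: filterI => //; apply: filterI; first by apply: open_nbhs_nbhs; split => //;
  exact: cdom_open.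
  by apply: (Cf.1 p0); apply: open_nbhs_nbhs; split => //; exact: cdom_open.
(* The C^1 neighbourhoods are indexed by compact subsets of a chart domain: regularity provides a
   closed, hence compact, neighbourhood of p0 inside the tube. *)
have [K' pK' K'A] := compact_regular (@mhausdorff _ M) cM filterT pA'.
pose K := closure K'.
have cK : compact K by apply: (subclosed_compact _ cM) => //; exact: closed_closure.
have fB : @C1_topology R M N (C1_nbhd f phi psi K (e0 / 2)).
  move=> O [Otop GO]; apply: GO; exists f, phi, psi, K, (e0 / 2); split => //.
    by split => // p /K'A [_ []].
  by move=> _ [p /K'A [_ [_ ?]] <-].
(* The subbasic neighbourhood is open for d and contains f, so it contains a d-ball around f; its
   radius r is the one sought near p0. *)
rewrite -dtop in fB.
have [|r r0 rB] := fB f.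
  split; first by move=> _ [p /K'A [_ [_ ?]] <-].
  by move=> x _; split => [|v _]; rewrite subrr normr0.
exists (K', [set g | d f g < r]) => /=.
  by split => //; exists r.
move=> [p g] /= [K'p /rB [gK gC]] v.
have Kp : K p by exact: subset_closure.
have [Ap [phip' psip']] := K'A p Kp.
have gp : cdom psi (g p) by apply: gK; exists p.
have Cg : C1_map g := dfun_C1 g.
have [gC1 gC2] := gC (phi p) (ex_intro2 _ _ p Kp erefl).
rewrite cfwdK // in gC1.
have [u' vE] : exists u', v = of_chart phi p u'.
  by exists (to_chart phi (tv p v)); rewrite (to_chartK (z := (tv p v))).
have [u0|u0] := eqVneq u' 0.
  have v0 : v = 0 by rewrite vE u0 linear0.
  rewrite v0.
  rewrite (tmap0 f p) (tmap0 g p).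
  rewrite (fsn0 sN (f p)) (fsn0 sN (g p)) subrr normr0.
  by apply: mulr_ge0; [exact: ltW|exact: (fsn_ge0 (@nrm_seminorm _ M))].
(* Both sides of the estimate are homogeneous in v, which reduces it to unit coordinate vectors. *)
have nu0 : 0 < `|u'| by rewrite normr_gt0.
pose u := `|u'|^-1 *: u'.
have nu : `|u| = 1 by rewrite /u normrZ normfV normr_id mulVf // gt_eqF.
have [k vk] : exists k : R, v = k *: of_chart phi p u.
  exists `|u'|.
  by rewrite vE /u linearZ /= scalerA divff ?scale1r // gt_eqF.
have /= := AE (p, e0 / 2) (conj Ap Ee) u nu (g p) (drep phi psi g p u) gp gC1.
have gC3 : `|drep phi psi f p u - drep phi psi g p u| < e0 / 2 by apply: gC2; rewrite nu.
move=> /(_ gC3).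
have -> : tv (g p) (of_chart psi (g p) (drep phi psi g p u)) = tmap g (tv p (of_chart
  phi p u)).
  have := to_chartK (z := tmap g (tv p (of_chart phi p u))) apsi gp.
  by rewrite (to_chart_tmap Cg aphi apsi) //= of_chartK // => ->.
move=> /ltW H; rewrite vk; move: (of_chart phi p u) H => w H.
exact: (homogeneous_close (fsn_tmapZ f sN p k w) (fsn_tmapZ g sN p k w)
  (fsnZ (@nrm_seminorm _ M) p k w) H).
Qed.

End Closeness.

(** * Stable subspaces of cone sequences *)

Section Stable.
Context {R : realType}.

(** Among the subspaces contained in P take one of maximal dimension: adding the line of a further
    vector of P would increase the dimension. *)
Lemma vspace_of_pred (m : nat) (P : 'rV[R]_m -> Prop) :
  P 0 -> (forall k u v, P u -> P v -> P (k *: u + v)) ->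
  exists W : {vspace 'rV[R]_m}, forall v, v \in W <-> P v.
Proof.
move=> P0 PD.
pose Q n := `[< exists U : {vspace 'rV[R]_m}, \dim U = n /\ forall v, v \in U -> P v >].
have exQ : exists n, Q n.
  exists 0%N; apply/asboolP; exists 0%VS; split; first exact: dimv0.
  by move=> v; rewrite memv0 => /eqP ->.
have Qm n : Q n -> (n <= m)%N.
  by move=> /asboolP[U [<- _]]; rewrite (leq_trans (dimvS (subvf U))) // dimvf /dim
    /= mul1n.
case: (ex_maxnP exQ Qm) => n /asboolP[W [Wn WP]] Wmax.
exists W => v; split; first exact: WP.
move=> Pv; apply: contrapT => /negP vW.
have : Q (\dim (W + <[v]>)).
  apply/asboolP; exists (W + <[v]>)%VS; split => // _ /memv_addP[w wW [_ /vlineP[k ->] ->]].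
  by rewrite addrC; apply: PD => //; exact: WP.
move=> /Wmax; rewrite -Wn => H.
have WE : W = (W + <[v]>)%VS by apply/eqP; rewrite eqEdim addvSl.
by move: vW; rewrite WE (subvP (addvSr _ _)) // memv_line.
Qed.

(** If l < 0 then phi is negative on some product A x B, while clustering yields t in A with h t in
    B. The dependence of phi on t lets the base point of a fibre move with the vector. *)
Lemma cluster_ge0 (T : Type) (F : set_system T) (X : topologicalType) (h : T -> X)
    (phi : T -> X -> R) (y : X) (l : R) : Filter F ->
  cluster (h @ F) y -> phi x.1 x.2 @[x --> filter_prod F (nbhs y)] --> l ->
  (\forall t \near F, 0 <= phi t (h t)) -> 0 <= l.
Proof.
move=> FF cy cphi Fphi; rewrite leNgt; apply/negP => l0.
have GF : Filter (filter_prod F (nbhs y)) by exact: filter_prod_filter.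
have l0' : 0 < - l by rewrite oppr_gt0.
move/cvgrPdist_lt: cphi => /(_ _ l0') [[A B] /= [FA yB] AB].
have FA' : (h @ F) [set h t | t in A `&` [set t | 0 <= phi t (h t)]].
  have FA2 : F (A `&` [set t | 0 <= phi t (h t)]) by exact: filterI.
  exact: (filterS (fun t tA => ex_intro2 _ _ t tA erefl) FA2).
have [_ [[t [At /= pt] <-] Bt]] := cy _ _ FA' yB.
have /= := AB (t, h t) (conj At Bt).
rewrite ltr_distlC => /andP[_]; rewrite subrr => H.
by move: pt; rewrite leNgt H.
Qed.

(** The positive lower bound is found on the unit sphere by compactness, uniformly for t near the
    limit, and extends by homogeneity. *)
Lemma norm_lower_near (m : nat) (T : Type) (F : set_system T)
    (N : T -> 'rV[R]_m -> R) (N0 : 'rV[R]_m -> R) : Filter F ->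
  (forall t k u, N t (k *: u) = `|k| * N t u) ->
  (forall u, `|u| = 1 -> 0 < N0 u) ->
  (forall u, N x.1 x.2 @[x --> filter_prod F (nbhs u)] --> N0 u) ->
  exists2 c, 0 < c & \forall t \near F, forall u, c * `|u| <= N t u.
Proof.
move=> FF Nh N0p Nc.
pose P (te : T * R) (u : 'rV[R]_m) := te.2 < N te.1 u.
have := (compact_near_coveringP _).1 (@compact_sphere R m).
have FFF : Filter (filter_prod F (0 : R)^'+) by exact: filter_prod_filter.
move=> /(_ _ (filter_prod F (0 : R)^'+) P FFF) [|[A E] /= [FA eE] AE].
  move=> u u1; have n0 : 0 < N0 u / 2 by rewrite divr_gt0 // N0p.
  have GF : Filter (filter_prod F (nbhs u)) by exact: filter_prod_filter.
  have /cvgrPdist_lt /(_ _ n0) [[A B] /= [FA uB] AB] := Nc u.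
  exists (B, [set te | A te.1 /\ te.2 < N0 u / 2]) => /=.
    split => //; exists (A, [set e | e < N0 u / 2]) => //=; split => //.
    by exists (N0 u / 2) => //= e /=; rewrite sub0r normrN => /ltr_normlW.
  move=> [v [t e]] /= [Bv [At eN]]; rewrite /P /=; apply: lt_trans eN _.
  have /= := AB (t, v) (conj At Bv); rewrite ltr_distlC => /andP[+ _].
  by rewrite {1}(splitr (N0 u)) addrK.
have [e0 /= e00 e0E] := eE.
have e20 : 0 < e0 / 2 by rewrite divr_gt0.
have Ee : E (e0 / 2).
  apply: e0E => //=; rewrite sub0r normrN ger0_norm ?ltW //.
  by rewrite ltr_pdivrMr // ltr_pMr // ltr1n.
exists (e0 / 2) => //; apply: filterS FA => t At u.
have [->|u0] := eqVneq u 0.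
  by rewrite normr0 mulr0 -[X in N _ X](scale0r 0) Nh normr0 mul0r.
have nu : 0 < `|u| by rewrite normr_gt0.
have u1 : `| `|u|^-1 *: u | = 1 by rewrite normrZ normfV normr_id mulVf // gt_eqF.
have := AE (t, e0 / 2) (conj At Ee) _ u1; rewrite /P /= Nh normfV normr_id => /ltW.
by rewrite ler_pdivlMl // mulrC.
Qed.

Lemma ler_geometric_unbounded (c B rho : R) (N : nat -> R) :
  0 < c -> 0 < rho -> rho < 1 -> (forall n, c <= rho ^+ n * N n) -> ~ forall n, N n <= B.
Proof.
move=> c0 r0 r1 cN NB.
have : (fun n => rho ^+ n * B) @ \oo --> (0 * B).
  by apply: cvgMr_tmp; apply: cvg_expr; rewrite ger0_norm // ltW.
rewrite mul0r => /cvgrPdist_lt /(_ _ c0) [n _ /(_ n (leqnn n))] /=.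
rewrite sub0r normrN => /ltr_normlW; apply/negP; rewrite -leNgt.
by apply: le_trans (cN n) _; rewrite ler_wpM2l // exprn_ge0 // ltW.
Qed.

Record seminorm (m : nat) (N : 'rV[R]_m -> R) : Prop := Seminorm {
  sn_ge0 : forall u, 0 <= N u;
  snD : forall u v, N (u + v) <= N u + N v;
  snZ : forall k u, N (k *: u) = `|k| * N u }.

Lemma sn0 (m : nat) (N : 'rV[R]_m -> R) : seminorm N -> N 0 = 0.
Proof. by move=> sN; rewrite -[X in N X](scale0r 0) (snZ sN) normr0 mul0r. Qed.

Lemma snB (m : nat) (N : 'rV[R]_m -> R) : seminorm N -> forall u v, N (u - v) <= N u + N v.
Proof.
by move=> sN u v; apply: le_trans (snD sN _ _) _; rewrite -scaleN1r (snZ sN) normrN1 mul1r.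
Qed.

(** * Cones in one tangent space, the seminorms of time n being pulled back to time 0 *)

Section StableSubspace.
Variables (m : nat) (a b : nat -> 'rV[R]_m -> R) (al rho : R).
Hypotheses (al0 : 0 < al) (al1 : al < 1) (rho0 : 0 < rho) (rho1 : rho < 1).
Hypotheses (sa : forall n, seminorm (a n)) (sb : forall n, seminorm (b n)).
Hypothesis expand : forall n v, al * a n v < b n v ->
  al * a n.+1 v < b n.+1 v /\ b n v <= rho * b n.+1 v.
Hypothesis contract : forall n v, al * b n.+1 v < a n.+1 v -> a n.+1 v <= rho * a n v.

(** As al < 1, a vector of the stable cone with a > 0 satisfies al b <= al^2 a < a, the condition
    under which [contract] applies. *)
Lemma cone_contract v : (forall n, b n v <= al * a n v) ->
  forall n, a n v <= rho ^+ n * a 0%N v.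
Proof.
move=> vW; elim=> [|n IH]; first by rewrite expr0 mul1r.
rewrite exprS -mulrA; apply: le_trans (_ : rho * a n v <= _);
last by rewrite ler_wpM2l // ltW.
have := sn_ge0 (sa n.+1) v; rewrite le_eqVlt => /orP[/eqP <-|a0].
  by rewrite mulr_ge0 ?(ltW rho0) // (sn_ge0 (sa n)).
apply: contract; apply: le_lt_trans (_ : al * (al * a n.+1 v) < _).
  by rewrite ler_wpM2l // ltW.
rewrite mulrA gtr_pMl // -[ltRHS](mulr1 1); apply: ltr_pM => //; exact: ltW.
Qed.

(** The open unstable cone is forward invariant, so its complement is invariant backwards in
    time. *)
Lemma cone_down v n : b n v <= al * a n v -> forall k, (k <= n)%N -> b k v <= al * a k v.
Proof.
elim: n => [|n IH] bn k; first by rewrite leqn0 => /eqP ->.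
rewrite leq_eqVlt => /orP[/eqP -> //|]; rewrite ltnS; apply: IH.
by rewrite leNgt; apply/negP => /expand[]; rewrite ltNge bn.
Qed.

Lemma cone_expand v k : al * a k v < b k v -> forall n,
  b k v <= rho ^+ n * b (n + k)%N v /\ al * a (n + k)%N v < b (n + k)%N v.
Proof.
move=> h; elim=> [|n [IH1 IH2]]; first by rewrite add0n expr0 mul1r.
have [h1 h2] := expand IH2; rewrite addSn; split => //.
apply: le_trans IH1 _; rewrite exprSr -mulrA; apply: ler_wpM2l h2.
exact/exprn_ge0/ltW.
Qed.

Lemma stable_closed k u v : (forall n, b n u <= al * a n u) ->
  (forall n, b n v <= al * a n v) -> forall n, b n (k *: u + v) <= al * a n (k *: u + v).
Proof.
move=> uW vW n; rewrite leNgt; apply/negP => h.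
have b0 : 0 < b n (k *: u + v).
  by apply: le_lt_trans h; rewrite mulr_ge0 ?(ltW al0) // (sn_ge0 (sa n)).
apply: (@ler_geometric_unbounded (b n (k *: u + v))
   (`|k| * (al * a 0%N u) + al * a 0%N v) rho (fun i => b (i + n)%N (k *: u + v))) => //.
  by move=> i; have [] := cone_expand h i.
have bound w : (forall n, b n w <= al * a n w) -> forall i, b i w <= al * a 0%N w.
  move=> wW i; apply: le_trans (wW i) _; apply: ler_wpM2l; first exact: ltW.
  apply: le_trans (cone_contract wW i) _; apply: ler_piMl; first exact: (sn_ge0 (sa 0%N)).
  by apply: exprn_ile1; exact: ltW.
move=> i; apply: le_trans (snD (sb _) _ _) _; rewrite (snZ (sb _)).
by apply: lerD; [rewrite ler_wpM2l // bound|exact: bound].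
Qed.

Hypotheses (ca : forall n, continuous (a n)) (cb : forall n, continuous (b n)).
Variables (U0 : {vspace 'rV[R]_m}) (S : nat -> {vspace 'rV[R]_m}).
Hypothesis pos : forall v, a 0%N v = 0 -> b 0%N v = 0 -> v = 0.
Hypothesis U0E : forall v, v \in U0 <-> a 0%N v = 0.
Hypothesis SE : forall n v, v \in S n -> b n v = 0.
Hypothesis dimS : forall n, (m <= \dim (S n) + \dim U0)%N.

Lemma cone_U0 v : b 0%N v <= al * a 0%N v -> v \in U0 -> v = 0.
Proof.
move=> h /U0E a0; apply: pos => //; apply/eqP; rewrite eq_le (sn_ge0 (sb 0%N)) andbT.
by rewrite (le_trans h) // a0 mulr0.
Qed.

(** By [cone_down] the vectors of S n lie in the cone at time 0, which meets U0 only in 0; the bound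
    [dimS] then makes S n a complement of U0. *)
Lemma S_decomp n v : exists2 w, w \in S n & v - w \in U0.
Proof.
have cap : (S n :&: U0 = 0)%VS.
  apply/eqP; rewrite -subv0; apply/subvP => w /memv_capP[wS wU].
  rewrite memv0; apply/eqP; apply: cone_U0 wU.
  apply: (@cone_down w n) => //.
  by rewrite (SE wS) mulr_ge0 ?(ltW al0) // (sn_ge0 (sa n)).
have full : (S n + U0 = fullv)%VS.
  apply/eqP; rewrite eqEdim subvf /= dimvf (dimv_disjoint_sum cap).
  by rewrite /dim /= mul1n.
have /memv_addP[w wS [u uU ->]] : v \in (S n + U0)%VS by rewrite full memvf.
by exists w => //; rewrite addrC addKr.
Qed.

(* S n is pulled back from time n and lies in the cone up to time n; the vectors
   of S n congruent to v modulo U0 are bounded and cluster as n grows. *)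
Lemma stable_decomp v : exists2 w, (forall n, b n w <= al * a n w) & v - w \in U0.
Proof.
have /boolp.choice[w wE] : forall n, exists w, w \in S n /\ v - w \in U0.
  by move=> n; have [w ? ?] := S_decomp n v; exists w.
(* An arbitrary filter: the family of seminorms below is constant in its parameter. *)
pose FT : set_system R := nbhs (0 : R).
have [c c0 cN] : exists2 c, 0 < c & \forall t \near FT, forall u,
  c * `|u| <= a 0%N u + b 0%N u.
  apply: (@norm_lower_near m R FT (fun _ u => a 0%N u + b 0%N u) (fun u =>
    a 0%N u + b 0%N u)).
  - by move=> _ k u; rewrite (snZ (sa 0%N)) (snZ (sb 0%N)) mulrDr.
  - move=> u u1; rewrite lt_neqAle addr_ge0 ?(sn_ge0 (sa _)) ?(sn_ge0 (sb _)) // andbT.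
    apply/eqP => /esym/eqP; rewrite paddr_eq0 ?(sn_ge0 (sa _)) ?(sn_ge0 (sb _)) //.
    move=> /andP[/eqP au /eqP bu]; move: u1; rewrite (pos au bu) normr0 => /eqP.
    by rewrite eq_sym oner_eq0.
  - move=> u; have GF : Filter (filter_prod FT (nbhs u)) by exact: filter_prod_filter.
    by apply: cvgD; [apply: (cvg_continuous_comp (h := a 0%N)) |
      apply: (cvg_continuous_comp (h := b 0%N))];
      [exact: ca|exact: cvg_snd|exact: cb|exact: cvg_snd].
have {}cN u : c * `|u| <= a 0%N u + b 0%N u by have := nbhs_singleton cN; apply.
have wW n k : (k <= n)%N -> b k (w n) <= al * a k (w n).
  apply: cone_down; rewrite (SE (wE n).1).
  by rewrite mulr_ge0 ?(ltW al0) // (sn_ge0 (sa n)).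
have a0 n : a 0%N (v - w n) = 0 by apply/U0E; exact: (wE n).2.
have aw n : a 0%N (w n) <= a 0%N v.
  have -> : w n = v - (v - w n) by rewrite subKr.
  apply: le_trans (snB (sa _) _ _) _.
  by rewrite a0 addr0.
have wB n : `|w n| <= (1 + al) * a 0%N v / c.
  rewrite ler_pdivlMr // mulrC; apply: le_trans (cN _) _.
  apply: le_trans (_ : (1 + al) * a 0%N (w n) <= _).
    by rewrite mulrDl mul1r lerD2l wW.
  by rewrite ler_wpM2l // addr_ge0 // ltW.
set B := (1 + al) * a 0%N v / c in wB.
have cK : compact [set u : 'rV[R]_m | `|u| <= B].
  apply: bounded_closed_compact.
    by exists B; split => [|x Bx u /= uB]; [exact: num_real|exact: le_trans uB (ltW Bx)].
  apply: (@closed_comp _ _ (fun u : 'rV[R]_m => `|u|) [set x | x <= B]).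
    by move=> u _; exact: norm_continuous.
  exact: closed_le.
have [|y [_ yc]] := cK (w @ \oo) _.
  by exists 0%N => // n _ /=; exact: wB.
have stat (f : 'rV[R]_m -> R) : continuous f -> (\forall n \near \oo,
  0 <= f (w n)) -> 0 <= f y.
  move=> cf; apply: (@cluster_ge0 _ \oo _ w (fun _ => f) y _ _ yc).
  have GF : Filter (filter_prod \oo (nbhs y)) by exact: filter_prod_filter.
  by apply: (cvg_continuous_comp (h := f)); [exact: cf|exact: cvg_snd].
exists y.
  move=> n; rewrite -subr_ge0; apply: (stat (fun u => al * a n u - b n u)).
    move=> u; have FU := nbhs_filter u.
    apply: (@cvgB _ _ _ _ FU (fun u => al * a n u) (b n)); last exact: cb.
    by apply: (@cvgM _ _ _ FU (fun=> al) (a n)); [exact: cvg_cst|exact: ca].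
  by exists n => // k /= nk; rewrite subr_ge0; exact: wW.
(* Congruence to v modulo U0 is the vanishing of a seminorm, hence a closed inequality that passes
   to the cluster point. *)
apply/U0E; apply/eqP; rewrite eq_le (sn_ge0 (sa _)) andbT -oppr_ge0.
apply: (stat (fun u => - a 0%N (v - u))).
  move=> u; have FU := nbhs_filter u.
  apply: (@cvgN _ _ _ _ FU (fun u => a 0%N (v - u))).
  apply: (cvg_continuous_comp (h := a 0%N)); first exact: ca.
  by apply: cvgB; [exact: cvg_cst|exact: cvg_id].
by exists 0%N => // n _; rewrite /= a0 oppr0.
Qed.

Lemma stable_subspace : exists W : {vspace 'rV[R]_m},
  [/\ forall v, v \in W <-> forall n, b n v <= al * a n v,
      (W :&: U0 = 0)%VS & (W + U0 = fullv)%VS].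
Proof.
have [|k u v|W WE] := @vspace_of_pred m (fun v => forall n, b n v <= al * a n v).
- by move=> n; rewrite (sn0 (sb n)) (sn0 (sa n)) mulr0.
- exact: stable_closed.
exists W; split => //.
  apply/eqP; rewrite -subv0; apply/subvP => w /memv_capP[/WE wS wU].
  by rewrite memv0; apply/eqP; exact: cone_U0 wU.
apply/eqP; rewrite eqEsubv subvf; apply/subvP => v _.
have [w /WE wW wU] := stable_decomp v.
by apply/memv_addP; exists w => //; exists (v - w) => //; rewrite addrC subrK.
Qed.

End StableSubspace.
End Stable.

(** * Continuity of stable subbundles *)

Section StableBundle.
Context {R : realType}.

Lemma of_chart_self (M : manifold R) (p : M) u : of_chart (chart_at p) p u = u.
Proof. by rewrite of_chartE drep_id //; exact: chart_at_dom. Qed.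

Lemma fsn_seminorm (M : manifold R) (N : tm M -> R) p :
  fseminorm N -> seminorm (fun v => N (tv p v)).
Proof. by move=> sN; split=> [u|u v|k u]; [exact: (fsn_ge0 sN)|exact: (fsnD
  sN)|exact: (fsnZ sN)]. Qed.

Lemma tcont_chart (M : manifold R) (N : tm M -> R) phi p u : tcont N ->
  atlas phi -> cdom phi p ->
  N (tv x.1 (of_chart phi x.1 x.2)) @[x --> filter_prod (nbhs p) (nbhs u)] -->
  N (tv p (of_chart phi p u)).
Proof.
move=> cN aphi phip; have GF : Filter (filter_prod (nbhs p) (nbhs u)) by exact:
  filter_prod_filter.
apply: (cN _ _ (fun x : M * 'rV[R]_(mdim M) => tv x.1 (of_chart phi x.1 x.2))).
apply: (tcvg_of_chart (P := fst) (U := snd)) => //; [exact: cvg_fst|exact: cvg_snd].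
Qed.

Lemma tcont_fiber (M : manifold R) (N : tm M -> R) p :
  tcont N -> continuous (fun v => N (tv p v)).
Proof.
move=> cN u; have FU := nbhs_filter u.
apply: (cN _ (nbhs u) (tv p) (tv p u) FU).
have pc : (fun=> p) @ nbhs u --> p by exact: cvg_cst.
have uc : id @ nbhs u --> u by exact: cvg_id.
have := tcvg_of_chart FU (chart_at_atlas p) (chart_at_dom p) pc uc.
rewrite of_chart_self; apply: tcvg_ext.
by near=> v; rewrite of_chart_self.
Unshelve. all: by end_near. Qed.

Section Bundle.
Variables (M : manifold R) (A B : nat -> tm M -> R) (al rho : R).
Hypotheses (al0 : 0 < al) (al1 : al < 1) (rho0 : 0 < rho) (rho1 : rho < 1).
Hypotheses (sA : forall n, fseminorm (A n)) (sB : forall n, fseminorm (B n)).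
Hypotheses (cA : forall n, tcont (A n)) (cB : forall n, tcont (B n)).
Hypothesis expand : forall n z, al * A n z < B n z ->
  al * A n.+1 z < B n.+1 z /\ B n z <= rho * B n.+1 z.
Hypothesis contract : forall n z, al * B n.+1 z < A n.+1 z -> A n.+1 z <= rho * A n z.
Hypothesis pos : forall p v, A 0%N (tv p v) = 0 -> B 0%N (tv p v) = 0 -> v = 0.
Variables (E0 U0 : M -> {vspace 'rV[R]_(mdim M)}).
Variable (S : nat -> M -> {vspace 'rV[R]_(mdim M)}).
Hypothesis cE0 : continuous_subbundle E0.
Hypothesis EU0 : forall p, (E0 p :&: U0 p = 0)%VS.
Hypothesis EUT : forall p, (E0 p + U0 p = fullv)%VS.
Hypothesis U0E : forall p v, v \in U0 p <-> A 0%N (tv p v) = 0.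
Hypothesis SE : forall n p v, v \in S n p -> B n (tv p v) = 0.
Hypothesis dimS : forall n p, (mdim M <= \dim (S n p) + \dim (U0 p))%N.

(** W p and E0 p are both complements of U0 p, so the projection onto W p along U0 p carries a local
    frame of E0 to one of W. The projected frame is continuous because it is locally bounded and its
    value is its only cluster point. *)
Lemma stable_bundle : exists W : M -> {vspace 'rV[R]_(mdim M)},
  continuous_subbundle W /\ forall p,
  [/\ forall v, v \in W p <-> forall n, B n (tv p v) <= al * A n (tv p v),
      (W p :&: U0 p = 0)%VS & (W p + U0 p = fullv)%VS].
Proof.
have /boolp.choice[W WE] : forall p, exists W : {vspace 'rV[R]_(mdim M)},
  [/\ forall v, v \in W <-> forall n, B n (tv p v) <= al * A n (tv p v),
      (W :&: U0 p = 0)%VS & (W + U0 p = fullv)%VS].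
  move=> p; apply: (@stable_subspace R (mdim M) (fun n v => A n (tv p v))
    (fun n v => B n (tv p v)) al rho al0 al1 rho0 rho1 _ _ _ _ _ _ (U0 p)
    (fun n => S n p)).
  - by move=> n; exact: fsn_seminorm.
  - by move=> n; exact: fsn_seminorm.
  - by move=> n v; exact: expand.
  - by move=> n v; exact: contract.
  - by move=> n; exact: tcont_fiber.
  - by move=> n; exact: tcont_fiber.
  - exact: pos.
  - exact: U0E.
  - by move=> n; exact: SE.
  - by move=> n; exact: dimS.
exists W; split => // p0.
have aphi := chart_at_atlas p0; have phip0 := chart_at_dom p0.
have [k [w wE]] := cE0 p0.
set phi := chart_at p0 in aphi phip0 wE *.
pose pr p := daddv_pi (W p) (U0 p).
have prW p v : pr p v \in W p by exact: memv_pi.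
have prU p v : v - pr p v \in U0 p.
  have [_ cap full] := WE p.
  have vWU : v \in (W p + U0 p)%VS by rewrite full memvf.
  rewrite -[X in X - _](daddv_pi_add cap vWU) addrC addKr; exact: memv_pi.
have prE p v x : x \in W p -> v - x \in U0 p -> x = pr p v.
  move=> xW xU; have [_ cap full] := WE p.
  apply/eqP; rewrite -subr_eq0 -memv0 -cap memv_cap memvB //=.
  have -> : x - pr p v = (v - pr p v) - (v - x) by rewrite opprB [RHS]addrC subrKA.
  by rewrite memvB.
pose om j p := to_chart phi (tv p (pr p (of_chart phi p (w j p)))).
have omE j p : cdom phi p -> of_chart phi p (om j p) = pr p (of_chart phi p (w j p)).
  by move=> phip; rewrite /om (to_chartK (z := tv p _)).
exists k, om.
have pD : \forall p \near p0, cdom phi p.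
  by apply: open_nbhs_nbhs; split => //; exact: cdom_open.
apply: filterS2 pD wE => p1 phip [cw bw]; split; last first.
  have [WP cap full] := WE p1.
  have -> : [seq of_chart phi p1 (om j p1) | j : 'I_k] =
      [seq pr p1 i | i <- [seq of_chart phi p1 (w j p1) | j : 'I_k]].
    by rewrite /image_mem -[RHS]map_comp; apply: eq_map => j /=; exact: omE.
  have kerE : (E0 p1 :&: lker (pr p1) = 0)%VS.
    apply/eqP; rewrite -subv0; apply/subvP => v /memv_capP[vE].
    rewrite memv_ker => /eqP v0; rewrite -(EU0 p1) memv_cap vE /=.
    by have := prU p1 v; rewrite v0 subr0.
  have -> : W p1 = (pr p1 @: E0 p1)%VS.
    apply/esym/eqP; rewrite eqEdim; apply/andP; split.
      by apply/subvP => _ /memv_imgP[v _ ->].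
    rewrite limg_dim_eq //.
    have := dimv_disjoint_sum cap; have := dimv_disjoint_sum (EU0 p1).
    by rewrite full EUT => -> /addIn ->.
  exact: limg_basis_of kerE bw.
move=> j; have [WP cap full] := WE p1.
have F1 : Filter (nbhs p1) by exact: nbhs_filter.
pose v1 := of_chart phi p1 (w j p1).
have near_phi : \forall p \near p1, cdom phi p.
  by apply: open_nbhs_nbhs; split => //; exact: cdom_open.
pose N p u := A 0%N (tv p (of_chart phi p u)) + B 0%N (tv p (of_chart phi p u)).
have [c c0 cN] : exists2 c, 0 < c & \forall p \near p1, forall u, c * `|u| <= N p u.
  apply: (@norm_lower_near R _ _ (nbhs p1) N (N p1)).
  - by move=> p a u; rewrite /N linearZ /= (fsnZ (sA _)) (fsnZ (sB _)) mulrDr.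
  - move=> u u1; rewrite /N lt_neqAle addr_ge0 ?(fsn_ge0 (sA _)) ?(fsn_ge0 (sB _)) // andbT.
    apply/eqP => /esym/eqP; rewrite paddr_eq0 ?(fsn_ge0 (sA _)) ?(fsn_ge0 (sB _)) //.
    move=> /andP[/eqP au /eqP bu]; have u0 := pos au bu.
    have := of_chartK u aphi phip; rewrite u0 /to_chart /drep linear0 => u0'.
    by move: u1; rewrite -u0' normr0 => /eqP; rewrite eq_sym oner_eq0.
  - move=> u; have GF : Filter (filter_prod (nbhs p1) (nbhs u)) by exact:
    filter_prod_filter.
    by apply: cvgD; apply: tcont_chart.
have cwj := cw j.
have tw : tcvg (nbhs p1) (fun p => tv p (of_chart phi p (w j p))) (tv p1 v1).
  by apply: (tcvg_of_chart (P := id)) => //; exact: cvg_id.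
have Aw := @cA 0%N _ _ _ _ F1 tw.
(* Removing a component in U0, where A 0 vanishes, does not increase A 0; the cone condition at time
   0 then bounds B 0. *)
have WA p : cdom phi p -> N p (om j p) <= (1 + al) * A 0%N (tv p (of_chart phi p (w j p))).
  move=> phip'; have [WP' _ _] := WE p.
  rewrite /N omE //; set v := of_chart phi p (w j p).
  have h1 : A 0%N (tv p (pr p v)) <= A 0%N (tv p v).
    have -> : pr p v = v - (v - pr p v) by rewrite subKr.
    apply: le_trans (fsnB (sA _) _ _ _) _.
    by rewrite [X in _ + X <= _]((U0E _ _).1 (prU p v)) addr0.
  have h2 := (WP' (pr p v)).1 (prW p v) 0%N.
  apply: le_trans (lerD (lexx _) h2) _.
  by rewrite -[X in X + _]mul1r -mulrDl ler_wpM2l // addr_ge0 // ltW.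
pose K := (1 + al) * (A 0%N (tv p1 v1) + 1) / c.
have omB : \forall p \near p1, `|om j p| <= K.
  move/cvgrPdist_lt: Aw => /(_ _ ltr01) Aw.
  apply: filterS3 near_phi cN Aw => p phip' cNp Ap.
  rewrite /K ler_pdivlMr // mulrC; apply: le_trans (cNp _) _.
  apply: le_trans (WA p phip') _; rewrite ler_wpM2l ?addr_ge0 ?(ltW al0) //.
  by apply: ltW; move: Ap; rewrite ltr_distlC => /andP[].
(* The margin 1 makes V a neighbourhood of the expected limit, whose norm may equal K. *)
pose V := [set u : 'rV[R]_(mdim M) | `|u| <= K + 1].
have omK1 : `|om j p1| <= K by exact: nbhs_singleton omB.
have cV : compact V.
  apply: bounded_closed_compact.
    by exists (K + 1); split => [|x Bx u /= uB];
    [exact: num_real|exact: le_trans uB (ltW Bx)].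
  apply: (@closed_comp _ _ (fun u : 'rV[R]_(mdim M) => `|u|) [set x | x <= K + 1]).
    by move=> u _; exact: norm_continuous.
  exact: closed_le.
have VF : (om j @ p1) V.
  by apply: filterS omB => p /le_trans; apply; rewrite lerDl.
have Vn : nbhs (om j p1) V.
  apply/nbhs_ballP; exists 1 => //= u; rewrite -ball_normE /= => h.
  have -> : u = om j p1 - (om j p1 - u) by rewrite subKr.
  by apply: le_trans (ler_normB _ _) _; rewrite lerD // ltW.
(* The projection is characterised by lying in W and differing from the original vector by an
   element of U0. Both are closed conditions jointly in base point and vector, so a cluster point
   satisfies them at p1. *)
have clE y : cluster (om j @ p1) y -> y = om j p1.
  move=> yc.
  have GF : Filter (filter_prod (nbhs p1) (nbhs y)) by exact: filter_prod_filter.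
  suff : of_chart phi p1 y = pr p1 v1.
    by move=> h; rewrite -[LHS](of_chartK _ aphi phip) h /om.
  apply: prE.
    apply/WP => n; rewrite -subr_ge0.
    apply: (@cluster_ge0 R _ (nbhs p1) _ (om j) (fun p u =>
      al * A n (tv p (of_chart phi p u)) -
      B n (tv p (of_chart phi p u))) y _ _ yc).
      apply: cvgB; last exact: tcont_chart.
      by apply: cvgM; [exact: cvg_cst|exact: tcont_chart].
    apply: filterS near_phi => p phip'; rewrite omE // subr_ge0.
    by have [WP' _ _] := WE p; apply: (WP' _).1.
  apply/U0E; apply/eqP; rewrite eq_le (fsn_ge0 (sA _)) andbT -oppr_ge0.
  apply: (@cluster_ge0 R _ (nbhs p1) _ (om j)
    (fun p u => - A 0%N (tv p (of_chart phi p (w j p - u)))) y _ _ yc).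
    apply: cvgN; rewrite /v1 -linearB.
    apply: (@cA 0%N _ _ (fun x : M * 'rV[R]_(mdim M) =>
      tv x.1 (of_chart phi x.1 (w j x.1 - x.2))) _ GF).
    apply: (tcvg_of_chart (P := fst)) => //; first exact: cvg_fst.
    apply: cvgB; last exact: cvg_snd.
    by apply: (cvg_continuous_comp (h := w j)); [exact: cwj|exact: cvg_fst].
  apply: filterS near_phi => p phip'.
  by rewrite linearB /= omE // ((U0E _ _).1 (prU p _)) oppr0.
have PF : ProperFilter (om j @ p1) by exact: fmap_proper_filter.
apply: (compact_cluster_set1 (@norm_hausdorff _ _) cV Vn PF VF).
apply/seteqP; split => [y /clE -> //|_ ->].
by have [y [_ yc]] := cV _ PF VF; rewrite -(clE _ yc).
Qed.

End Bundle.
End StableBundle.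

(** * Orbits of families *)

Section Closure.
Context {R : realType}.

Lemma fsn_tmap (M N : manifold R) (f : M -> N) (P : tm N -> R) :
  fseminorm P -> fseminorm (P \o tmap f).
Proof.
move=> sP; split=> [z|p u v|p k u]; first exact: (fsn_ge0 sP).
  have -> : (P \o tmap f) (tv p (u + v)) = P (tv (f p) (diff_map f p u + diff_map f p v)).
    by rewrite /= /tmap /= linearD.
  exact: (fsnD sP).
exact: (fsn_tmapZ f sP).
Qed.

Lemma tcont_tmap (M N : manifold R) (f : M -> N) (P : tm N -> R) :
  C1_map f -> tcont P -> tcont (P \o tmap f).
Proof. by move=> Cf cP T F h z FF hz; apply: cP; exact: tcvg_tmap. Qed.

Lemma fsn_proj (M : manifold R) (E E' : M -> {vspace 'rV[R]_(mdim M)}) (P : tm M -> R) :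
  fseminorm P -> fseminorm (P \o tproj E E').
Proof.
move=> sP; split=> [z|p u v|p k u]; first exact: (fsn_ge0 sP).
  by rewrite /= /tproj /= linearD; exact: (fsnD sP).
by rewrite /= /tproj /= linearZ; exact: (fsnZ sP).
Qed.

Lemma tcont_proj (M : manifold R) (E E' : M -> {vspace 'rV[R]_(mdim M)}) (P : tm M -> R) :
  tmcont (tproj E E') -> tcont P -> tcont (P \o tproj E E').
Proof. by move=> Cf cP T F h z FF hz; apply: cP; exact: Cf. Qed.

Lemma fsn_wsum (M : manifold R) (n : nat) (k : nat -> R) (P : nat -> tm M -> R) :
  (forall i, 0 <= k i) -> (forall i, fseminorm (P i)) ->
  fseminorm (fun z => \sum_(i < n) k i * P i z).
Proof.
move=> k0 sP; split=> [z|p u v|p c u].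
- by apply: sumr_ge0 => i _; rewrite mulr_ge0 // (fsn_ge0 (sP i)).
- rewrite -big_split /=; apply: ler_sum => i _; rewrite -mulrDr.
  by apply: ler_wpM2l => //; exact: (fsnD (sP i)).
- by rewrite mulr_sumr; apply: eq_bigr => i _; rewrite (fsnZ (sP i)) mulrCA.
Qed.

Lemma tcont_wsum (M : manifold R) (n : nat) (k : nat -> R) (P : nat -> tm M -> R) :
  (forall i, tcont (P i)) -> tcont (fun z => \sum_(i < n) k i * P i z).
Proof.
move=> cP T F h z FF hz; apply: cvg_rsum => i _.
by apply: cvgM; [exact: cvg_cst|exact: cP].
Qed.

Lemma diff_map_bij (M N : manifold R) (f : M -> N) (f' : N -> M) p :
  C1_map f -> C1_map f' -> cancel f f' -> cancel f' f ->
  (lker (diff_map f p) = 0)%VS /\ limg (diff_map f p) = fullv.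
Proof.
move=> Cf Cf' fK f'K.
have idE : f' \o f = id by apply/funext => q /=.
have idE' : f \o f' = id by apply/funext => q /=.
split.
  apply/eqP; rewrite -subv0; apply/subvP => v; rewrite memv_ker memv0 => /eqP v0.
  have := tmap_comp (tv p v) Cf Cf'; rewrite idE tmap_id => /(congr1 snd) /= ->.
  by rewrite v0 linear0.
apply/eqP; rewrite eqEsubv subvf; apply/subvP => w _.
have := tmap_comp (tv (f p) w) Cf' Cf; rewrite idE' tmap_id => /(congr1 snd) /= ->.
by rewrite fK memv_img ?memvf.
Qed.

(* The cone conditions only bound dim E from above along orbits; the lower bound
   comes from the transversality EU. *)
Section DimOrbit.
Variables (N : nat -> manifold R) (h : forall n, N n -> N n.+1).
Variables (H : forall n, N 0%N -> N n).
Hypotheses (H0 : H 0 = id) (HS : forall n, H n.+1 = @h n \o H n).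
Hypothesis (Ch : forall n, C1_map (@h n)).
Hypothesis (hbij : forall n p, (lker (diff_map (@h n) p) = 0)%VS /\
  limg (diff_map (@h n) p) = fullv).
Variables (E U : forall n, N n -> {vspace 'rV[R]_(mdim (N n))}).
Hypotheses (EU0 : forall n (p : N n), (E p :&: U p = 0)%VS).
Hypotheses (EUT : forall n (p : N n), (E p + U p = fullv)%VS).
Hypothesis EU : forall n (p : N n) v, v \in E p ->
  diff_map (@h n) p v \in U (h p) -> v = 0.

Lemma C1_orbit n : C1_map (H n).
Proof.
elim: n => [|n IH]; first by rewrite H0; exact: C1_map_id.
by rewrite HS; apply: C1_map_comp.
Qed.

Lemma diff_map_orbit_surj n p : limg (diff_map (H n) p) = fullv.
Proof.
apply/eqP; rewrite eqEsubv subvf /=.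
elim: n => [|n IH]; apply/subvP => w _.
  have -> : w = diff_map (H 0) p w; last by rewrite memv_img ?memvf.
  by rewrite H0; have := tmap_id (tv p w) => /(congr1 snd).
have [_ sh] := hbij (H n p).
have : w \in limg (diff_map (@h n) (H n p)) by rewrite sh memvf.
move=> /memv_imgP[w' _ ->].
have /memv_imgP[v _ ->] : w' \in limg (diff_map (H n) p) by apply: (subvP IH); exact: memvf.
have := tmap_comp (tv p v) (C1_orbit n) (@Ch n); rewrite -HS => /(congr1 snd) /= <-.
by rewrite memv_img ?memvf.
Qed.

(** The image of E p under the injective Dh meets U (h p) only in 0, so its dimension is at most the
    codimension of U (h p). *)
Lemma dim_step n (p : N n) : (\dim (E p) <= \dim (E (h p)))%N.
Proof.
have [kh _] := hbij p.
have dE : \dim (diff_map (@h n) p @: E p) = \dim (E p).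
  by apply: limg_dim_eq; rewrite kh capv0.
have cap : (diff_map (@h n) p @: E p :&: U (h p) = 0)%VS.
  apply/eqP; rewrite -subv0; apply/subvP => _ /memv_capP[/memv_imgP[v vE ->] vU].
  by rewrite memv0 (EU vE vU) linear0.
rewrite -dE -(leq_add2r (\dim (U (h p)))).
rewrite -(dimv_disjoint_sum cap) -(dimv_disjoint_sum (EU0 (h p))).
by rewrite EUT dimvS ?subvf.
Qed.

Lemma dim_orbit n p : (mdim (N 0%N) <=
  \dim (diff_map (H n) p @^-1: E (H n p)) + \dim (U p))%N.
Proof.
have dE : (\dim (E p) <= \dim (E (H n p)))%N.
  elim: n => [|n IH]; first by rewrite H0.
  by apply: leq_trans IH _; rewrite HS; exact: dim_step.
have mE : mdim (N 0%N) = (\dim (E p) + \dim (U p))%N.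
  by rewrite -(dimv_disjoint_sum (EU0 p)) EUT dimvf /dim /= mul1n.
rewrite [leqLHS]mE leq_add2r; apply: leq_trans dE _.
rewrite -{1}(lpreimK (f := diff_map (H n) p) (W := E (H n p)));
first by rewrite -[leqRHS](limg_ker_dim (diff_map (H n) p)) leq_addl.
by rewrite diff_map_orbit_surj subvf.
Qed.

End DimOrbit.
End Closure.

(** * The derivative of a family on the union of all tangent bundles *)

Section Total.
Context {R : realType} (M : int -> riemannian R).

(* One type for all the T M_i: the iterates of tot_fwd and tot_bwd can be shifted
   without transporting along equalities between indices. *)
Definition tot_tangent : Type := {i : int & tm (M i)}.
Definition tot (i : int) (x : tm (M i)) : tot_tangent := existT (fun j => tm (M j)) i x.

Definition tot_fwd (f : diffeo_family M) (z : tot_tangent) : tot_tangent :=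
  let: existT i x := z in tot (tmap (f i) x).
Definition tot_bwd (f : diffeo_family M) (z : tot_tangent) : tot_tangent :=
  let: existT i x := z in tot (tmap (@inv_step R M f i) x).
Definition tnrm (z : tot_tangent) : R := let: existT i x := z in nrm x.

Section Fam.
Variable f : diffeo_family M.

(* inv_step with an arbitrary proof of j + 1 = k, so that it can be destructed. *)
Definition inv_gen (j k : int) (e : j + 1 = k) (p : M k) : M j :=
  Defs.dinv (f j) (ecast l (M l) (esym e) p).

Lemma C1_inv_gen j k (e : j + 1 = k) : C1_map (inv_gen e).
Proof. by case: k / e; exact: dinv_C1. Qed.

Lemma C1_inv_step i : C1_map (@inv_step R M f i).
Proof. exact: (C1_inv_gen (subrK 1 i)). Qed.

Lemma inv_gen_bij j k (e : j + 1 = k) p :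
  (lker (diff_map (inv_gen e) p) = 0)%VS /\ limg (diff_map (inv_gen e) p) = fullv.
Proof.
case: k / e p => p; apply: (diff_map_bij (f' := f j)).
- exact: dinv_C1.
- exact: dfun_C1.
- exact: dinvK.
- exact: dfunK.
Qed.

Lemma dfun_bij i p :
  (lker (diff_map (f i) p) = 0)%VS /\ limg (diff_map (f i) p) = fullv.
Proof.
apply: (diff_map_bij (f' := Defs.dinv (f i))).
- exact: dfun_C1.
- exact: dinv_C1.
- exact: dfunK.
- exact: dinvK.
Qed.

Lemma tmap_dinvK i (x : tm (M (i + 1))) : tmap (f i) (tmap (Defs.dinv (f i)) x) = x.
Proof.
rewrite -tmap_comp; [|exact: dinv_C1|exact: dfun_C1].
have -> : f i \o Defs.dinv (f i) = id by apply/funext => q /=; exact: dinvK.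
exact: tmap_id.
Qed.

Lemma tmap_dfunK i (x : tm (M i)) : tmap (Defs.dinv (f i)) (tmap (f i) x) = x.
Proof.
rewrite -tmap_comp; [|exact: dfun_C1|exact: dinv_C1].
have -> : Defs.dinv (f i) \o f i = id by apply/funext => q /=; exact: dfunK.
exact: tmap_id.
Qed.

Lemma tot_bwdK : cancel (tot_bwd f) (tot_fwd f).
Proof.
move=> [i x] /=.
have H j k (e : j + 1 = k) (y : tm (M k)) :
    tot (tmap (f j) (tmap (inv_gen e) y)) = tot y.
  by case: k / e y => y; congr tot; exact: tmap_dinvK.
exact: (H _ _ (subrK 1 i)).
Qed.

(** The two sides live over i + 1 - 1 and i, equal but not convertible; in [H] the index j is a
    variable, so that the equality can be destructed. *)
Lemma tot_fwdK : cancel (tot_fwd f) (tot_bwd f).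
Proof.
move=> [i x] /=.
have H j (E : i = j) (e : j + 1 = i + 1) :
    tot (tmap (inv_gen e) (tmap (f i) x)) = tot x.
  case: j / E e => e; rewrite (eq_irrelevance e erefl).
  by congr tot; exact: tmap_dfunK.
by apply: (H _ _ (subrK 1 (i + 1))); rewrite addrK.
Qed.

Lemma fwd_iterS n i : @fwd_iter R M f n.+1 i =
  f (iter n (fun j => j + 1) i) \o @fwd_iter R M f n i.
Proof. by []. Qed.

Lemma bwd_iterS n i : @bwd_iter R M f n.+1 i = @inv_step R M f _ \o @bwd_iter R M f n i.
Proof. by []. Qed.

Lemma C1_fwd_iter n i : C1_map (@fwd_iter R M f n i).
Proof.
elim: n => [|n IH]; first exact: C1_map_id.
by rewrite fwd_iterS; apply: C1_map_comp => //; exact: dfun_C1.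
Qed.

Lemma C1_bwd_iter n i : C1_map (@bwd_iter R M f n i).
Proof.
elim: n => [|n IH]; first exact: C1_map_id.
by rewrite bwd_iterS; apply: C1_map_comp => //; exact: C1_inv_step.
Qed.

Lemma iter_tot_fwd n i (x : tm (M i)) :
  iter n (tot_fwd f) (tot x) = tot (tmap (@fwd_iter R M f n i) x).
Proof.
elim: n => [|n IH]; first by rewrite /= tmap_id.
rewrite iterS IH fwd_iterS /=; congr tot.
exact: esym (tmap_comp x (C1_fwd_iter n i) (dfun_C1 _)).
Qed.

Lemma iter_tot_bwd n i (x : tm (M i)) :
  iter n (tot_bwd f) (tot x) = tot (tmap (@bwd_iter R M f n i) x).
Proof.
elim: n => [|n IH]; first by rewrite /= tmap_id.
rewrite iterS IH bwd_iterS /=; congr tot.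
exact: esym (tmap_comp x (C1_bwd_iter n i) (C1_inv_step _)).
Qed.

End Fam.
End Total.

(** * Adapted seminorms and cones *)

Section Adapted.
Context {R : realType}.

Lemma geometric_dominated (c lam mu : R) : 0 < lam -> lam < mu ->
  exists2 n, (0 < n)%N & c * lam ^+ n <= mu ^+ n.
Proof.
move=> l0 lm; have m0 : 0 < mu by exact: lt_trans lm.
have r1 : `|lam / mu| < 1.
  by rewrite ger0_norm ?divr_ge0 ?ltW // ltr_pdivrMr // mul1r.
have : (fun n => c * (lam / mu) ^+ n) @ \oo --> (c * 0).
  by apply: cvgM; [exact: cvg_cst|exact: cvg_expr].
rewrite mulr0 => /cvgrPdist_lt /(_ _ ltr01) [n _ H].
exists n.+1 => //; have /= := H n.+1 (leqnSn n).
rewrite sub0r normrN => /ltr_normlW /ltW.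
by rewrite expr_div_n mulrA ler_pdivrMr ?exprn_gt0 // mul1r.
Qed.

Section AdaptedNorm.
Variables (Z : Type) (T q : Z -> Z) (N : Z -> R) (c lam mu : R) (n0 : nat).
Hypotheses (N0 : forall z, 0 <= N z) (Tq : forall z, T (q z) = q (T z)).
Hypotheses (mu0 : 0 < mu) (c0 : 0 < c) (lam0 : 0 < lam) (lam1 : lam < 1).
Hypotheses (n00 : (0 < n0)%N) (n0E : c * lam ^+ n0 <= mu ^+ n0).
Hypothesis decay : forall n z, (0 < n)%N ->
  N (iter n T (q z)) <= c * lam ^+ n * N (q z).

(* Since c lam^n0 <= mu^n0, the term n0 created by the shift T is dominated by the
   term 0, so that a finite sum, hence a continuous one, suffices. *)
Definition adapted z := \sum_(n < n0) mu^-1 ^+ n * N (iter n T (q z)).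
(** The factor 1 + c covers both term 0, whose bound is 1, and the later terms, whose bound is c.
    Only c, mu and n0 enter, so the constant is the same for all indices. *)
Definition adapted_cst := \sum_(n < n0) mu^-1 ^+ n * (1 + c).

Let term_ge0 n z : 0 <= mu^-1 ^+ n * N (iter n T (q z)).
Proof. by rewrite mulr_ge0 // exprn_ge0 // invr_ge0 ltW. Qed.

Lemma adapted_ge z : N (q z) <= adapted z.
Proof.
rewrite /adapted; case: n0 n00 => // n _.
rewrite big_ord_recl expr0 mul1r lerDl; apply: sumr_ge0 => i _; exact: term_ge0.
Qed.

Lemma adapted_cst_ge1 : 1 <= adapted_cst.
Proof.
rewrite /adapted_cst; case: n0 n00 => // n _.
rewrite big_ord_recl expr0 mul1r -addrA lerDl addr_ge0 ?(ltW c0) // sumr_ge0 // => i _.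
by rewrite mulr_ge0 // ?exprn_ge0 ?invr_ge0 ?addr_ge0 // ?ltW.
Qed.

Lemma adapted_le z : adapted z <= adapted_cst * N (q z).
Proof.
rewrite /adapted_cst mulr_suml; apply: ler_sum => -[n _] _ /=.
rewrite -mulrA ler_wpM2l ?exprn_ge0 ?invr_ge0 ?(ltW mu0) //.
case: n => [|n]; first by rewrite /= mulrDl mul1r lerDl mulr_ge0 // ltW.
apply: le_trans (decay _ _) _ => //; rewrite ler_wpM2r //.
apply: le_trans (_ : c <= _); last by rewrite lerDr.
by rewrite ger_pMr // exprn_ile1 // ltW.
Qed.

Lemma adapted_contract z : adapted (T z) <= mu * adapted z.
Proof.
pose u n := mu^-1 ^+ n * N (iter n T (q z)).
have E : adapted (T z) = mu * \sum_(n < n0) u n.+1.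
  rewrite mulr_sumr; apply: eq_bigr => n _; rewrite -Tq -iterSr /u exprS !mulrA.
  by rewrite divff ?mul1r // gt_eqF.
rewrite E; apply: ler_wpM2l; first exact: ltW.
have E2 : u 0%N + \sum_(n < n0) u n.+1 = adapted z + u n0.
  by transitivity (\sum_(n < n0.+1) u n); [rewrite big_ord_recl|rewrite big_ord_recr].
suff : u n0 <= u 0%N by move=> h; lra.
rewrite /u expr0 mul1r /= exprVn mulrC ler_pdivrMr ?exprn_gt0 //.
apply: le_trans (decay _ n00) _; rewrite mulrC.
exact: ler_wpM2l.
Qed.

End AdaptedNorm.

Section ConeArithmetic.
(** Here fa, fb and ga, gb are the seminorms of Df z and Dg z, and nz is |z|. The choice delta (1 +
    al) = tau al makes the error delta |z| at most tau b when al a < b, at most tau a when al b < a,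
    and at most tau al b when a <= al b. With tau half of 1 - mu, rho is both mu + tau and 1 -
    tau. *)
Variables (al mu tau delta rho a b fa fb ga gb nz : R).
Hypotheses (tauE : tau = (1 - mu) / 2) (rhoE0 : rho = (1 + mu) / 2).
Hypotheses (deltaE : delta * (1 + al) = tau * al).
Hypotheses (al0 : 0 < al) (al1 : al < 1) (mu0 : 0 < mu) (mu1 : mu < 1).
Hypotheses (a0 : 0 <= a) (b0 : 0 <= b) (fb0 : 0 <= fb) (gb0 : 0 <= gb).
Hypotheses (faE : fa <= mu * a) (fbE : b <= mu * fb) (nzE : nz <= a + b).
Hypotheses (gaE : `|fa - ga| <= delta * nz) (gbE : `|fb - gb| <= delta * nz).

Let tau0 : 0 < tau. Proof. by rewrite tauE divr_gt0 // subr_gt0. Qed.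
Let rhoE : rho = mu + tau. Proof. by rewrite rhoE0 tauE; field. Qed.
Let rhoE' : rho = 1 - tau. Proof. by rewrite rhoE0 tauE; field. Qed.
Let al10 : 0 < 1 + al. Proof. by rewrite addr_gt0. Qed.
Let delta0 : 0 < delta.
Proof. by rewrite -(pmulr_lgt0 _ al10) deltaE mulr_gt0. Qed.

Let err_le e x : a + b <= x -> delta * x <= e -> delta * nz <= e.
Proof.
move=> h; apply: le_trans; apply: ler_wpM2l; first exact: ltW.
exact: le_trans nzE h.
Qed.

Let fb_ge : b <= fb.
Proof. by apply: le_trans fbE _; rewrite ler_piMl // ltW. Qed.

Lemma cone_expand_arith : al * a < b -> al * ga < gb /\ b <= rho * gb.
Proof.
move=> h; have Hfa := faE; have Hfb := fbE; have Ht := tau0; have Ha := al0;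
have Ha1 := al1; have Hm := mu0; have Hm1 := mu1.
have b_gt0 : 0 < b by apply: le_lt_trans h; rewrite mulr_ge0 // ltW.
have e : delta * nz <= tau * b.
  apply: (err_le (x := (1 + al) / al * b)).
    rewrite mulrAC ler_pdivlMr //; nra.
  have -> : delta * ((1 + al) / al * b) = (delta * (1 + al)) / al * b by field;
  rewrite gt_eqF.
  by rewrite deltaE mulfK // gt_eqF.
have gb1 : fb - tau * b <= gb by move: gbE; rewrite ler_norml => /andP[_ ?]; lra.
have ga1 : ga <= mu * a + tau * b by move: gaE; rewrite ler_norml => /andP[? _]; lra.
have r0 : 0 < rho by rewrite rhoE; lra.
have r1 : rho < 1 by rewrite rhoE'; lra.
(* Writing rho fb = mu fb + tau fb, the first term is at least b and the second at least tau rho b,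
   which pays for the error. *)
have H2 : b <= rho * gb.
  have h1 : rho * (fb - tau * b) <= rho * gb by rewrite ler_wpM2l // ltW.
  apply: le_trans h1; rewrite mulrBr {1}rhoE.
  have h2 : tau * (rho * b) <= tau * fb.
    rewrite ler_wpM2l ?(ltW tau0) //; apply: le_trans fb_ge.
    by rewrite ler_piMl // ltW.
  rewrite mulrCA; nra.
split => //.
(* The cone condition follows from al ga <= mu b + tau b = rho b < b <= gb. *)
have h3 : b <= gb by apply: le_trans H2 _; rewrite ler_piMl // ltW.
have h4 : al * ga <= al * (mu * a + tau * b) by rewrite ler_wpM2l // ltW.
have h5 : mu * (al * a) <= mu * b by rewrite ler_wpM2l // ltW.
have h6 : al * (tau * b) <= tau * b by rewrite ler_piMl ?(ltW al1) // mulr_ge0 // ltW.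
have h7 : rho * b < b by rewrite gtr_pMl.
have h8 : rho * b = mu * b + tau * b by rewrite rhoE mulrDl.
have h9 : al * (mu * a + tau * b) = mu * (al * a) + al * (tau * b) by ring.
lra.
Qed.

(** If a <= al b, then al gb >= (1 - tau) al b = (mu + tau) al b >= ga, against the assumption. This
    first conclusion is the cone invariance of the inverse map, with a and b exchanged. *)
Lemma cone_contract_arith : al * gb < ga -> al * b < a /\ ga <= rho * a.
Proof.
move=> h; have Hfa := faE; have Hfb := fbE; have Ht := tau0; have Ha := al0;
have Ha1 := al1; have Hm := mu0; have Hm1 := mu1.
have ab : al * b < a.
  rewrite ltNge; apply/negP => ha.
  have e : delta * nz <= tau * (al * b).
    apply: (err_le (x := (1 + al) * b)); first by rewrite mulrDl mul1r addrC lerD2l.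
    by rewrite mulrA deltaE mulrA.
  have gb1 : fb - tau * (al * b) <= gb by move: gbE; rewrite ler_norml => /andP[_ ?]; lra.
  have ga1 : ga <= mu * a + tau * (al * b) by move: gaE;
  rewrite ler_norml => /andP[? _]; lra.
  have h1 : al * (fb - tau * (al * b)) <= al * gb by rewrite ler_wpM2l // ltW.
  have h2 : mu * a <= mu * (al * b) by rewrite ler_wpM2l // ltW.
  have h3 : al * b <= al * fb by rewrite ler_wpM2l // ltW.
  have h4 : al * (tau * (al * b)) <= tau * (al * b).
    by rewrite ler_piMl ?(ltW al1) // !mulr_ge0 // ltW.
  have h5 : mu * (al * b) + tau * (al * b) = al * b - tau * (al * b).
    by rewrite -mulrDl -rhoE rhoE' mulrBl mul1r.
  rewrite mulrBr in h1; lra.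
split => //.
have e : delta * nz <= tau * a.
  apply: (err_le (x := (1 + al) / al * a)).
    rewrite mulrAC ler_pdivlMr //; nra.
  have -> : delta * ((1 + al) / al * a) = (delta * (1 + al)) / al * a by field;
  rewrite gt_eqF.
  by rewrite deltaE mulfK // gt_eqF.
have ga1 : ga <= mu * a + tau * a by move: gaE; rewrite ler_norml => /andP[? _]; lra.
by rewrite rhoE mulrDl.
Qed.

End ConeArithmetic.
End Adapted.

Section AdaptedPair.
Context {R : realType} (M : int -> riemannian R).

Lemma daddv_pi_uniq (m : nat) (E E' : {vspace 'rV[R]_m}) v x :
  (E :&: E' = 0)%VS -> (E + E' = fullv)%VS -> x \in E -> v - x \in E' -> daddv_pi E
    E' v = x.
Proof.
move=> cap full xE xE'.
have vEE : v \in (E + E')%VS by rewrite full memvf.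
apply/eqP; rewrite -subr_eq0 -memv0 -cap memv_cap memvB ?memv_pi //=.
have -> : daddv_pi E E' v - x = (v - x) - (v - daddv_pi E E' v).
  by rewrite opprB [RHS]addrC subrKA.
rewrite memvB // -[X in X - _](daddv_pi_add cap vEE) addrC addKr; exact: memv_pi.
Qed.

Lemma daddv_pi_split (m : nat) (E E' : {vspace 'rV[R]_m}) v :
  (E :&: E' = 0)%VS -> (E + E' = fullv)%VS -> v = daddv_pi E E' v + daddv_pi E' E v.
Proof.
by move=> cap full; rewrite daddv_pi_add // full memvf.
Qed.

Lemma tproj_tmap (M1 M2 : manifold R) (h : M1 -> M2)
    (E E' : M1 -> {vspace 'rV[R]_(mdim M1)}) (F F' : M2 -> {vspace 'rV[R]_(mdim M2)}) x :
  (E x.1 :&: E' x.1 = 0)%VS -> (E x.1 + E' x.1 = fullv)%VS ->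
  (F (h x.1) :&: F' (h x.1) = 0)%VS -> (F (h x.1) + F' (h x.1) = fullv)%VS ->
  (forall v, v \in E x.1 -> diff_map h x.1 v \in F (h x.1)) ->
  (forall v, v \in E' x.1 -> diff_map h x.1 v \in F' (h x.1)) ->
  tmap h (tproj E E' x) = tproj F F' (tmap h x).
Proof.
move=> cap full cap' full' hE hE'; rewrite /tmap /tproj /=; congr tv.
apply/esym/daddv_pi_uniq => //; first by rewrite hE // memv_pi.
rewrite -linearB hE' // {1}(daddv_pi_split x.2 cap full) addrC addKr; exact: memv_pi.
Qed.

Definition tot_proj (E E' : forall i, M i -> {vspace 'rV[R]_(mdim (M i))})
    (z : tot_tangent M) : tot_tangent M :=
  let: existT i x := z in tot (tproj (@E i) (@E' i) x).

(** What the perturbation argument retains of the hyperbolic estimates. C and mu do not depend on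
    the index; the upper bounds are by the components of z and not by |z|, as the projections may
    have unbounded norms over the indices. *)
Record adapted_pair (f : diffeo_family M)
    (Es Eu : forall i, M i -> {vspace 'rV[R]_(mdim (M i))})
    (a b : tot_tangent M -> R) (C mu : R) : Prop := AdaptedPair {
  ap_mu0 : 0 < mu; ap_mu1 : mu < 1; ap_C : 1 <= C;
  ap_aT : forall z, a (tot_fwd f z) <= mu * a z;
  ap_bT : forall z, b (tot_bwd f z) <= mu * b z;
  ap_a_ge : forall z, tnrm (tot_proj Es Eu z) <= a z;
  ap_b_ge : forall z, tnrm (tot_proj Eu Es z) <= b z;
  ap_a_le : forall z, a z <= C * tnrm (tot_proj Es Eu z);
  ap_b_le : forall z, b z <= C * tnrm (tot_proj Eu Es z);
  ap_a_sn : forall i, fseminorm (fun x : tm (M i) => a (tot x));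
  ap_b_sn : forall i, fseminorm (fun x : tm (M i) => b (tot x));
  ap_a_c : forall i, tcont (fun x : tm (M i) => a (tot x));
  ap_b_c : forall i, tcont (fun x : tm (M i) => b (tot x)) }.

Lemma tnrm_ge0 (z : tot_tangent M) : 0 <= tnrm z.
Proof. by case: z => i x; exact: (fsn_ge0 (@nrm_seminorm _ (M i))). Qed.

Lemma anosov_adapted (f : diffeo_family M) Es Eu :
  anosov_splitting f Es Eu -> exists a b C mu, adapted_pair f Es Eu a b C mu.
Proof.
move=> hs; have [lam [c [/andP[lam0 lam1] c0 hyp]]] := EsEu_hyperbolic hs.
(* Any rate strictly between lam and 1 serves: the loss of rate absorbs the constant c. *)
pose mu := (1 + lam) / 2.
have lm : lam < mu by rewrite /mu; lra.
have mu0 : 0 < mu by exact: lt_trans lm.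
have mu1 : mu < 1 by rewrite /mu; lra.
have [n0 n00 n0E] := geometric_dominated c lam0 lm.
have TF E E' (cap : forall i (p : M i), (E i p :&: E' i p = 0)%VS)
    (full : forall i (p : M i), (E i p + E' i p = fullv)%VS)
    (inv : forall i (p : M i), (diff_map (f i) p @: E i p)%VS = E _ (f i p))
    (inv' : forall i (p : M i), (diff_map (f i) p @: E' i p)%VS = E' _ (f i p)) z :
    tot_fwd f (tot_proj E E' z) = tot_proj E E' (tot_fwd f z).
  case: z => i x; rewrite /tot_proj /tot_fwd /=; congr tot.
  apply: tproj_tmap; [exact: cap|exact: full|exact: cap|exact: full| |].
    by move=> v vE; rewrite -inv memv_img.
  by move=> v vE; rewrite -inv' memv_img.
have cap' i (p : M i) : (Eu i p :&: Es i p = 0)%VS by rewrite capvC (EsEu_cap hs).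
have full' i (p : M i) : (Eu i p + Es i p = fullv)%VS by rewrite addvC (EsEu_sum hs).
have TFs := TF _ _ (EsEu_cap hs) (EsEu_sum hs) (Es_invariant hs) (Eu_invariant hs).
have TFu := TF _ _ cap' full' (Eu_invariant hs) (Es_invariant hs).
have TBu z : tot_bwd f (tot_proj Eu Es z) = tot_proj Eu Es (tot_bwd f z).
  by rewrite -{1}(tot_bwdK f z) -TFu tot_fwdK.
have decs n z : (0 < n)%N -> tnrm (iter n (tot_fwd f) (tot_proj Es Eu z)) <=
    c * lam ^+ n * tnrm (tot_proj Es Eu z).
  move=> n1; case: z => i x; rewrite [tot_proj _ _ _]/= iter_tot_fwd.
  by have [+ _] := hyp i n x.1 n1; apply; exact: memv_pi.
have decu n z : (0 < n)%N -> tnrm (iter n (tot_bwd f) (tot_proj Eu Es z)) <=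
    c * lam ^+ n * tnrm (tot_proj Eu Es z).
  move=> n1; case: z => i x; rewrite [tot_proj _ _ _]/= iter_tot_bwd.
  by have [_ +] := hyp i n x.1 n1; apply; exact: memv_pi.
have pc i : tmcont (tproj (@Es i) (@Eu i)).
  by apply: proj_cont; [exact: (Es_continuous hs)|exact: (Eu_continuous hs)|
    exact: (EsEu_sum hs)|exact: (EsEu_cap hs)].
have pc' i : tmcont (tproj (@Eu i) (@Es i)).
  by apply: proj_cont; [exact: (Eu_continuous hs)|exact: (Es_continuous hs)|
    exact: full'|exact: cap'].
have mu10 n : 0 <= mu^-1 ^+ n by rewrite exprn_ge0 // invr_ge0 ltW.
exists (adapted (tot_fwd f) (tot_proj Es Eu) (@tnrm R M) mu n0).
exists (adapted (tot_bwd f) (tot_proj Eu Es) (@tnrm R M) mu n0).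
exists (adapted_cst c mu n0), mu.
have aE i : (fun x : tm (M i) => adapted (tot_fwd f) (tot_proj Es Eu) (@tnrm R M) mu
  n0 (tot x)) =
  (fun x => \sum_(n < n0) mu^-1 ^+ n *
    (((@nrm _ _) \o tmap (@fwd_iter R M f n i)) \o tproj (@Es i) (@Eu i)) x).
  apply/funext => x; apply: eq_bigr => n _; congr (_ * _).
  by rewrite [tot_proj _ _ _]/= iter_tot_fwd.
have bE i : (fun x : tm (M i) => adapted (tot_bwd f) (tot_proj Eu Es) (@tnrm R M) mu
  n0 (tot x)) =
  (fun x => \sum_(n < n0) mu^-1 ^+ n *
    (((@nrm _ _) \o tmap (@bwd_iter R M f n i)) \o tproj (@Eu i) (@Es i)) x).
  apply/funext => x; apply: eq_bigr => n _; congr (_ * _).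
  by rewrite [tot_proj _ _ _]/= iter_tot_bwd.
split => //.
- exact: adapted_cst_ge1.
- exact: (adapted_contract tnrm_ge0 TFs mu0 n00 n0E decs).
- exact: (adapted_contract tnrm_ge0 TBu mu0 n00 n0E decu).
- exact: (adapted_ge _ _ tnrm_ge0 mu0 n00).
- exact: (adapted_ge _ _ tnrm_ge0 mu0 n00).
- exact: (adapted_le n0 tnrm_ge0 mu0 c0 lam0 lam1 decs).
- exact: (adapted_le n0 tnrm_ge0 mu0 c0 lam0 lam1 decu).
- move=> i; rewrite aE.
  apply: (@fsn_wsum R (M i) n0 (fun n => mu^-1 ^+ n) (fun n =>
    ((@nrm R _ \o tmap (@fwd_iter R M f n i)) \o tproj (@Es i) (@Eu i)))) => [n|n];
    first exact: mu10.
  exact/fsn_proj/fsn_tmap/nrm_seminorm.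
- move=> i; rewrite bE.
  apply: (@fsn_wsum R (M i) n0 (fun n => mu^-1 ^+ n) (fun n =>
    ((@nrm R _ \o tmap (@bwd_iter R M f n i)) \o tproj (@Eu i) (@Es i)))) => [n|n];
    first exact: mu10.
  exact/fsn_proj/fsn_tmap/nrm_seminorm.
- move=> i; rewrite aE.
  apply: (@tcont_wsum R (M i) n0 (fun n => mu^-1 ^+ n) (fun n =>
    ((@nrm R _ \o tmap (@fwd_iter R M f n i)) \o tproj (@Es i) (@Eu i)))) => n.
  apply: tcont_proj; first exact: pc.
  by apply: tcont_tmap; [exact: C1_fwd_iter|exact: nrm_cont].
- move=> i; rewrite bE.
  apply: (@tcont_wsum R (M i) n0 (fun n => mu^-1 ^+ n) (fun n =>
    ((@nrm R _ \o tmap (@bwd_iter R M f n i)) \o tproj (@Eu i) (@Es i)))) => n.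
  apply: tcont_proj; first exact: pc'.
  by apply: tcont_tmap; [exact: C1_bwd_iter|exact: nrm_cont].
Qed.

Section Half.
(** One time direction in the abstract: T is the derivative of g or of its inverse, [It n] the n-th
    iterate on the base and [lev n] its effect on the index. The backward instance exchanges a with
    b and E with U. *)
Variables (T : tot_tangent M -> tot_tangent M) (lev : nat -> int -> int).
Variable It : forall n i, M i -> M (lev n i).
Hypothesis CIt : forall n i, C1_map (@It n i).
Hypothesis ItE : forall n i (x : tm (M i)), iter n T (tot x) = tot (tmap (@It n i) x).
Variables (a b : tot_tangent M -> R) (al rho : R).
Hypotheses (al0 : 0 < al) (al1 : al < 1) (rho0 : 0 < rho) (rho1 : rho < 1).
Hypotheses (sa : forall i, fseminorm (fun x : tm (M i) => a (tot x))).
Hypotheses (sb : forall i, fseminorm (fun x : tm (M i) => b (tot x))).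
Hypotheses (ca : forall i, tcont (fun x : tm (M i) => a (tot x))).
Hypotheses (cb : forall i, tcont (fun x : tm (M i) => b (tot x))).
Hypothesis expand : forall z, al * a z < b z ->
  al * a (T z) < b (T z) /\ b z <= rho * b (T z).
Hypothesis contract : forall z, al * b (T z) < a (T z) -> a (T z) <= rho * a z.
Variables (E U : forall i, M i -> {vspace 'rV[R]_(mdim (M i))}).
Hypothesis cE : forall i, continuous_subbundle (@E i).
Hypothesis EU0 : forall i (p : M i), (E p :&: U p = 0)%VS.
Hypothesis EUT : forall i (p : M i), (E p + U p = fullv)%VS.
Hypothesis UE : forall i (p : M i) v, v \in U p <-> a (tot (tv p v)) = 0.
Hypothesis EE : forall i (p : M i) v, v \in E p <-> b (tot (tv p v)) = 0.
Hypothesis dimE : forall n i (p : M i), (mdim (M i) <=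
  \dim (diff_map (@It n i) p @^-1: E (It n p)) + \dim (U p))%N.

Let A i n (x : tm (M i)) := a (iter n T (tot x)).
Let B i n (x : tm (M i)) := b (iter n T (tot x)).

Let AE i n : @A i n = (fun y => a (tot y)) \o tmap (@It n i).
Proof. by apply/funext => x; rewrite /A ItE. Qed.
Let BE i n : @B i n = (fun y => b (tot y)) \o tmap (@It n i).
Proof. by apply/funext => x; rewrite /B ItE. Qed.
Let sA i n : fseminorm (@A i n).
Proof. by rewrite AE; apply: (@fsn_tmap _ _ _ _ (fun y => a (tot y))); exact: sa. Qed.
Let sB i n : fseminorm (@B i n).
Proof. by rewrite BE; apply: (@fsn_tmap _ _ _ _ (fun y => b (tot y))); exact: sb. Qed.
Let cA i n : tcont (@A i n).
Proof. by rewrite AE; apply: (@tcont_tmap _ _ _ _ (fun y => a (tot y)));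
[exact: CIt|exact: ca]. Qed.
Let cB i n : tcont (@B i n).
Proof. by rewrite BE; apply: (@tcont_tmap _ _ _ _ (fun y => b (tot y)));
[exact: CIt|exact: cb]. Qed.

Lemma half_bundle i : exists W : M i -> {vspace 'rV[R]_(mdim (M i))},
  continuous_subbundle W /\ forall p,
  [/\ forall v, v \in W p <-> forall n, b (iter n T (tot (tv p v))) <= al * a (iter n
    T (tot (tv p v))),
      (W p :&: U p = 0)%VS & (W p + U p = fullv)%VS].
Proof.
apply: (@stable_bundle R (M i) (@A i) (@B i) al rho al0 al1 rho0 rho1 _ _ _ _ _ _ _
  (@E i) (@U i) (fun n p => (diff_map (@It n i) p @^-1: E (It n p))%VS)).
- exact: sA.
- exact: sB.
- exact: cA.
- exact: cB.
- by move=> n z; rewrite /A /B !iterS; exact: expand.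
- by move=> n z; rewrite /A /B !iterS; exact: contract.
- move=> p v /UE vU /EE vE; apply/eqP; rewrite -memv0 -(EU0 p) memv_cap vU.
  by rewrite andbT.
- exact: cE.
- exact: EU0.
- exact: EUT.
- exact: UE.
- by move=> n p v; rewrite -memv_preim /B ItE => /EE.
- by move=> n p; exact: dimE.
Qed.

Lemma half_contract (z : tot_tangent M) :
  (forall n, b (iter n T z) <= al * a (iter n T z)) ->
  forall n, a (iter n T z) <= rho ^+ n * a z.
Proof.
case: z => i [p v] h n.
apply: (@cone_contract R (mdim (M i)) (fun n v => A n (tv p v)) (fun n v => B n (tv p v))
  al rho al0 al1 rho0 _ _ v h n).
- by move=> m; exact: fsn_seminorm.
- by move=> m w; rewrite /A /B !iterS; exact: contract.
Qed.

End Half.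
End AdaptedPair.

(** * Perturbation of Anosov families *)

Section Perturbation.
Context {R : realType} (M : int -> riemannian R).

Lemma daddv_pi_eq0 (m : nat) (E E' : {vspace 'rV[R]_m}) v :
  (E :&: E' = 0)%VS -> (E + E' = fullv)%VS -> daddv_pi E E' v = 0 <-> v \in E'.
Proof.
move=> cap full; split => [v0|vE'].
  by rewrite (daddv_pi_split v cap full) v0 add0r memv_pi.
by apply: daddv_pi_uniq => //; rewrite ?mem0v ?subr0.
Qed.

Lemma tnrm_eq0 i (p : M i) v : tnrm (tot (tv p v)) = 0 <-> v = 0.
Proof.
split=> [h|->]; last exact: (fsn0 (@nrm_seminorm _ (M i))).
by apply: contrapT => /eqP v0; have := rnorm_gt0 p v0;
rewrite -[X in _ < X]/(tnrm (tot (tv p v))) h ltxx.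
Qed.

Lemma adapted_eq0 (E E' : forall i, M i -> {vspace 'rV[R]_(mdim (M i))})
    (a : tot_tangent M -> R) (C : R) :
  (forall i (p : M i), (E i p :&: E' i p = 0)%VS) ->
  (forall i (p : M i), (E i p + E' i p = fullv)%VS) ->
  (forall z, tnrm (tot_proj E E' z) <= a z) ->
  (forall z, a z <= C * tnrm (tot_proj E E' z)) ->
  forall i (p : M i) v, v \in E' i p <-> a (tot (tv p v)) = 0.
Proof.
move=> cap full a_ge a_le i p v.
have pE : tot_proj E E' (tot (tv p v)) = tot (tv p (daddv_pi (E i p) (E' i p) v)) by [].
have h1 := a_ge (tot (tv p v)); have h2 := a_le (tot (tv p v)).
rewrite pE in h1 h2.
rewrite -(daddv_pi_eq0 v (cap i p) (full i p)) -(tnrm_eq0 p).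
split=> h; first by move: h1 h2; rewrite h mulr0 => ? ?; apply/eqP; rewrite eq_le;
apply/andP.
by apply/eqP; rewrite eq_le tnrm_ge0 andbT -h.
Qed.

Lemma tnrm_proj_le (E E' : forall i, M i -> {vspace 'rV[R]_(mdim (M i))}) z :
  (forall i (p : M i), (E i p :&: E' i p = 0)%VS) ->
  (forall i (p : M i), (E i p + E' i p = fullv)%VS) ->
  tnrm (tot_proj E E' z) <= tnrm z + tnrm (tot_proj E' E z).
Proof.
case: z => i [p v] cap full.
have := fsnB (@nrm_seminorm _ (M i)) p v (daddv_pi (E' i p) (E i p) v).
by rewrite {1}(daddv_pi_split v (cap i p) (full i p)) addrK.
Qed.

Lemma tnrm_le_proj (E E' : forall i, M i -> {vspace 'rV[R]_(mdim (M i))}) z :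
  (forall i (p : M i), (E i p :&: E' i p = 0)%VS) ->
  (forall i (p : M i), (E i p + E' i p = fullv)%VS) ->
  tnrm z <= tnrm (tot_proj E E' z) + tnrm (tot_proj E' E z).
Proof.
case: z => i [p v] cap full.
have := fsnD (@nrm_seminorm _ (M i)) p (daddv_pi (E i p) (E' i p) v) (daddv_pi (E' i
  p) (E i p) v).
by rewrite -(daddv_pi_split v (cap i p) (full i p)).
Qed.

(** Here ns and nu are the norms of the components of z. Since al C = 1/2, nu <= b <= al a <= ns /
    2, whence ns <= 2 nz whatever the angle. The factor 4 C collects this 2, the C of a <= C ns, and
    the 2 of an + bn <= 2 an. *)
Lemma orbit_bound (C al r nz ns nu a b an bn nn : R) :
  1 <= C -> al = (2 * C)^-1 -> 0 <= r ->
  ns <= nz + nu -> nu <= b -> b <= al * a -> a <= C * ns -> 0 <= a ->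
  an <= r * a -> bn <= al * an -> 0 <= an -> nn <= an + bn ->
  nn <= 4 * C * r * nz.
Proof.
move=> C1 alE r0 h1 h2 h3 h4 a0 h5 h6 an0 h7.
have C0 : 0 < C by exact: lt_le_trans C1.
have al0 : 0 < al by rewrite alE invr_gt0 mulr_gt0.
have alC : al * C = 2^-1 by rewrite alE; field; rewrite gt_eqF.
have al1 : al <= 1 by rewrite alE invf_le1 ?mulr_gt0 //; lra.
have h8 : al * a <= 2^-1 * ns by rewrite -alC -mulrA ler_wpM2l // ltW.
have h9 : ns <= 2 * nz by lra.
have h10 : a <= C * (2 * nz) by apply: le_trans h4 _; rewrite ler_wpM2l // ltW.
have h11 : al * an <= an by rewrite ler_piMl.
have h12 : r * a <= r * (C * (2 * nz)) by rewrite ler_wpM2l.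
have -> : 4 * C * r * nz = 2 * (r * (C * (2 * nz))) by ring.
lra.
Qed.

Lemma dist0_le (x y x' e : R) : x = x' -> y = 0 -> 0 <= x' -> `|x - y| <= e -> x' <= e.
Proof. by move=> -> -> h; rewrite subr0 ger0_norm. Qed.

Section Perturb.
Variables (f g : diffeo_family M) (Es Eu : forall i, M i -> {vspace 'rV[R]_(mdim (M i))}).
Hypothesis hs : anosov_splitting f Es Eu.
Variables (a b : tot_tangent M -> R) (C mu : R).
Hypothesis ap : adapted_pair f Es Eu a b C mu.
Variables (al tau delta rho : R).
Hypotheses (alE : al = (2 * C)^-1) (tauE : tau = (1 - mu) / 2).
Hypotheses (deltaE : delta = tau * al / (1 + al)) (rhoE : rho = (1 + mu) / 2).
Hypothesis ga : forall z, `|a (tot_fwd f z) - a (tot_fwd g z)| <= delta * tnrm z.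
Hypothesis gb : forall z, `|b (tot_fwd f z) - b (tot_fwd g z)| <= delta * tnrm z.
(* gc only serves to show that Dg maps the stable subspaces of f transversally to
   its unstable ones. *)
Hypothesis gc : forall z,
  `|a (tot_bwd f (tot_fwd f z)) - a (tot_bwd f (tot_fwd g z))| <= delta * tnrm z.

Let mu0 := ap_mu0 ap.
Let mu1 := ap_mu1 ap.
Let C0 : 0 < C. Proof. exact: lt_le_trans (ap_C ap). Qed.
Let al0 : 0 < al. Proof. by rewrite alE invr_gt0 mulr_gt0. Qed.
Let al1 : al < 1.
Proof.
rewrite alE invf_lt1 ?mulr_gt0 //; apply: lt_le_trans (_ : 2 * 1 <= _).
  by rewrite mulr1 ltr1n.
by rewrite ler_pM2l // (ap_C ap).
Qed.
Let al10 : 0 < 1 + al. Proof. by rewrite addr_gt0. Qed.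
Let deltaE' : delta * (1 + al) = tau * al.
Proof. by rewrite deltaE divfK // gt_eqF. Qed.
Let tau0 : 0 < tau. Proof. by rewrite tauE divr_gt0 // subr_gt0. Qed.
Let rhoE' : rho = 1 - tau. Proof. by rewrite rhoE tauE; field. Qed.
Let rhoE2 : rho = mu + tau. Proof. by rewrite rhoE tauE; field. Qed.
Let rho0 : 0 < rho. Proof. by rewrite rhoE2 addr_gt0. Qed.
Let rho1 : rho < 1. Proof. by rewrite rhoE' ltrBlDr ltrDl. Qed.
Let delta1 : delta < 1.
Proof.
rewrite deltaE ltr_pdivrMr // mul1r; apply: lt_le_trans (_ : 1 * al <= _).
  by rewrite ltr_pM2r // -subr_gt0 -rhoE'.
by rewrite mul1r lerDr.
Qed.

Let a0 z : 0 <= a z. Proof. exact: le_trans (tnrm_ge0 _) (ap_a_ge ap z). Qed.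
Let b0 z : 0 <= b z. Proof. exact: le_trans (tnrm_ge0 _) (ap_b_ge ap z). Qed.
Let cap := EsEu_cap hs.
Let full := EsEu_sum hs.
Let cap' i (p : M i) : (Eu p :&: Es p = 0)%VS. Proof. by rewrite capvC cap. Qed.
Let full' i (p : M i) : (Eu p + Es p = fullv)%VS. Proof. by rewrite addvC full. Qed.
Let UE : forall i (p : M i) v, v \in Eu p <-> a (tot (tv p v)) = 0.
Proof. exact: (adapted_eq0 cap full (ap_a_ge ap) (ap_a_le ap)). Qed.
Let EE : forall i (p : M i) v, v \in Es p <-> b (tot (tv p v)) = 0.
Proof. exact: (adapted_eq0 cap' full' (ap_b_ge ap) (ap_b_le ap)). Qed.

Let tnrm_le z : tnrm z <= a z + b z.
Proof.
apply: le_trans (tnrm_le_proj z cap full) _.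
by apply: lerD; [exact: (ap_a_ge ap)|exact: (ap_b_ge ap)].
Qed.

Let bF z : b z <= mu * b (tot_fwd f z).
Proof. by rewrite -{1}(tot_fwdK f z); exact: (ap_bT ap). Qed.

Let expandF z : al * a z < b z ->
  al * a (tot_fwd g z) < b (tot_fwd g z) /\ b z <= rho * b (tot_fwd g z).
Proof.
exact: (cone_expand_arith tauE rhoE deltaE' al0 al1 mu0 mu1 (a0 z) (b0 z) (b0 _)
  (b0 _) (ap_aT ap z) (bF z) (tnrm_le z) (ga z) (gb z)).
Qed.

Let contractF z : al * b (tot_fwd g z) < a (tot_fwd g z) ->
  al * b z < a z /\ a (tot_fwd g z) <= rho * a z.
Proof.
exact: (cone_contract_arith tauE rhoE deltaE' al0 al1 mu0 mu1 (b0 z) (b0 _)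
  (ap_aT ap z) (bF z) (tnrm_le z) (ga z) (gb z)).
Qed.

Let contractF2 z : al * b (tot_fwd g z) < a (tot_fwd g z) -> a (tot_fwd g z) <= rho * a z.
Proof. by case/contractF. Qed.

(** Time reversal: [contractF] at the preimage of z under Dg is an expansion of a under the
    inverse. *)
Let expandB z : al * b z < a z ->
  al * b (tot_bwd g z) < a (tot_bwd g z) /\ a z <= rho * a (tot_bwd g z).
Proof.
by move=> h; rewrite -{3}(tot_bwdK g z); apply: contractF; rewrite tot_bwdK.
Qed.

Let contractB z : al * a (tot_bwd g z) < b (tot_bwd g z) ->
  b (tot_bwd g z) <= rho * b z.
Proof. by move=> /expandF[_]; rewrite tot_bwdK. Qed.

Let a0_pull z : a (tot_fwd f z) = 0 -> a z = 0.
Proof.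
case: z => i [q w] h; have /UE : a (tot (tv (f i q) (diff_map (f i) q w))) = 0 by [].
rewrite -(Eu_invariant hs) => /memv_imgP[u uE Duw].
have [ker _] := dfun_bij f q.
suff -> : w = u by apply/UE.
apply/eqP; rewrite -subr_eq0 -memv0 -ker memv_ker linearB /= Duw subrr eqxx //.
Qed.

(** Pulling Dg z back by Df gives a vector of Eu, where a vanishes, so [gc] yields a z <= delta |z|
    <= delta a z with delta < 1. Comparing Df z with Dg z directly would only make a (Df z) small,
    which says nothing of a z. *)
Let transF i (p : M i) v : v \in Es p -> diff_map (g i) p v \in Eu (g i p) -> v = 0.
Proof.
move=> vE DU; pose z := tot (tv p v).
have bz : b z = 0 by apply/EE.
have aGz : a (tot_fwd g z) = 0 by apply/UE.
have aBz : a (tot_bwd f (tot_fwd g z)) = 0 by apply: a0_pull; rewrite tot_bwdK.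
have h : a z <= delta * tnrm z.
  exact: (dist0_le (congr1 a (tot_fwdK f z)) aBz (a0 z) (gc z)).
have az : a z = 0.
  apply/eqP; rewrite eq_le a0 andbT leNgt; apply/negP => az.
  have h2 : a z <= delta * a z.
    apply: le_trans h _; apply: ler_wpM2l.
      by rewrite deltaE divr_ge0 ?mulr_ge0 // ltW.
    by have := tnrm_le z; rewrite bz addr0.
  by move: h2; rewrite leNgt gtr_pMl // delta1.
apply/eqP; rewrite -memv0 -(cap p) memv_cap vE /=; exact/UE.
Qed.

Let transB i (p : M i) v : v \in Eu p ->
  diff_map (@inv_step R M g i) p v \in Es (inv_step g p) -> v = 0.
Proof.
move=> /UE av0 DE; set w := diff_map _ p v in DE.
have E : tot_fwd g (tot (tv (inv_step g p) w)) = tot (tv p v).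
  exact: (tot_bwdK g (tot (tv p v))).
have w0 : w = 0.
  apply: (transF DE); apply/UE.
  by rewrite -[LHS]/(a (tot_fwd g (tot (tv (inv_step g p) w)))) E.
have [ker _] := inv_gen_bij g (subrK 1 i) p.
by apply/eqP; rewrite -memv0 -ker memv_ker -/w; apply/eqP.
Qed.

Let dimF n i (p : M i) : (mdim (M i) <=
  \dim (diff_map (@fwd_iter R M g n i) p @^-1: Es (fwd_iter g n p)) + \dim (Eu p))%N.
Proof.
apply: (@dim_orbit R (fun n => M (iter n (fun j => j + 1) i))
  (fun n => g (iter n (fun j => j + 1) i)) (fun n => @fwd_iter R M g n i) erefl
  (fun n => erefl) _ _ (fun n => @Es _) (fun n => @Eu _) _ _ _ n p).
- by move=> m; exact: dfun_C1.
- by move=> m q; exact: dfun_bij.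
- by move=> m q; exact: cap.
- by move=> m q; exact: full.
- by move=> m q v; exact: transF.
Qed.

Let dimB n i (p : M i) : (mdim (M i) <=
  \dim (diff_map (@bwd_iter R M g n i) p @^-1: Eu (bwd_iter g n p)) + \dim (Es p))%N.
Proof.
apply: (@dim_orbit R (fun n => M (iter n (fun j => j - 1) i))
  (fun n => @inv_step R M g (iter n (fun j => j - 1) i)) (fun n =>
    @bwd_iter R M g n i) erefl
  (fun n => erefl) _ _ (fun n => @Eu _) (fun n => @Es _) _ _ _ n p).
- by move=> m; exact: C1_inv_step.
- by move=> m q; exact: (inv_gen_bij g (subrK 1 _)).
- by move=> m q; exact: cap'.
- by move=> m q; exact: full'.
- by move=> m q v; exact: transB.
Qed.

Let halfF := @half_bundle R M (tot_fwd g) (fun n i => iter n (fun j => j + 1) i)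
  (fun n i => @fwd_iter R M g n i) (C1_fwd_iter g) (@iter_tot_fwd R M g) a b al rho
  al0 al1 rho0 rho1 (ap_a_sn ap) (ap_b_sn ap) (ap_a_c ap) (ap_b_c ap)
  expandF contractF2 Es Eu (Es_continuous hs) cap full UE EE dimF.

Let halfB := @half_bundle R M (tot_bwd g) (fun n i => iter n (fun j => j - 1) i)
  (fun n i => @bwd_iter R M g n i) (C1_bwd_iter g) (@iter_tot_bwd R M g) b a al rho
  al0 al1 rho0 rho1 (ap_b_sn ap) (ap_a_sn ap) (ap_b_c ap) (ap_a_c ap)
  expandB contractB Eu Es (Eu_continuous hs) cap' full' EE UE dimB.

Lemma perturbed_anosov : anosov g.
Proof.
pose Ws i := projT1 (cid (halfF i)); pose Wu i := projT1 (cid (halfB i)).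
have WsE i (p : M i) : [/\ forall v, v \in Ws i p <-> forall n,
    b (iter n (tot_fwd g) (tot (tv p v))) <= al * a (iter n (tot_fwd g) (tot (tv p v))),
    (Ws i p :&: Eu p = 0)%VS & (Ws i p + Eu p = fullv)%VS].
  exact: (projT2 (cid (halfF i))).2.
have WuE i (p : M i) : [/\ forall v, v \in Wu i p <-> forall n,
    a (iter n (tot_bwd g) (tot (tv p v))) <= al * b (iter n (tot_bwd g) (tot (tv p v))),
    (Wu i p :&: Es p = 0)%VS & (Wu i p + Es p = fullv)%VS].
  exact: (projT2 (cid (halfB i))).2.
have Ws_in i (p : M i) v : v \in Ws i p <-> forall n,
    b (iter n (tot_fwd g) (tot (tv p v))) <= al * a (iter n (tot_fwd g) (tot (tv p v))).
  by have [] := WsE i p.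
have Wu_in i (p : M i) v : v \in Wu i p <-> forall n,
    a (iter n (tot_bwd g) (tot (tv p v))) <= al * b (iter n (tot_bwd g) (tot (tv p v))).
  by have [] := WuE i p.
(* The two cone conditions at time 0 give a <= al^2 a, hence a = 0 and then b = 0. *)
have Wcap i (p : M i) : (Ws i p :&: Wu i p = 0)%VS.
  apply/eqP; rewrite -subv0; apply/subvP => v /memv_capP[/Ws_in/(_ 0%N)/= h1
    /Wu_in/(_ 0%N)/= h2].
  set z := tot (tv p v) in h1 h2.
  have az : a z = 0.
    apply/eqP; rewrite eq_le a0 andbT leNgt; apply/negP => az.
    have h3 : a z <= al * (al * a z) by apply: le_trans h2 _; rewrite ler_wpM2l // ltW.
    have h4 : al * (al * a z) < a z.
      apply: lt_trans (_ : al * a z < _); last by rewrite gtr_pMl.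
      by rewrite ltr_pM2l // gtr_pMl.
    by move: h3; rewrite leNgt h4.
  have bz : b z = 0 by apply/eqP; rewrite eq_le b0 andbT (le_trans h1) // az mulr0.
  by rewrite -(cap p) memv_cap; apply/andP; split; [exact/EE|exact/UE].
have surj i (p : M i) w : exists v, w = diff_map (g i) p v.
  have [_ sj] := dfun_bij g p.
  have /memv_imgP[v _ ->] : w \in limg (diff_map (g i) p) by rewrite sj memvf.
  by exists v.
exists Ws, Wu; split.
- by move=> i; exact: (projT2 (cid (halfF i))).1.
- by move=> i; exact: (projT2 (cid (halfB i))).1.
(* Ws is a complement of Eu and Wu one of Es, so their dimensions are those of Es and Eu and add up
   to the whole. *)
- move=> i p; apply/eqP; rewrite eqEdim subvf /= (dimv_disjoint_sum (Wcap i p)).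
  have [_ c1 f1] := WsE i p; have [_ c2 f2] := WuE i p.
  have := dimv_disjoint_sum c1; have := dimv_disjoint_sum c2;
  have := dimv_disjoint_sum (cap p).
  rewrite f1 f2 full => d1 d2 d3.
  have E : \dim (Wu i p) = \dim (Eu p).
    by apply/eqP; rewrite -(eqn_add2r (\dim (Es p))) -d2 d1 addnC.
  by rewrite E -d3.
- exact: Wcap.
- move=> i p; apply/eqP; rewrite eqEsubv; apply/andP; split; apply/subvP => w.
    by move=> /memv_imgP[v /Ws_in vW ->]; apply/Ws_in => n; have := vW n.+1; rewrite iterSr.
  (* The forward orbit of Dg v says nothing about v at time 0; forward invariance of the unstable
     cone supplies this missing condition. *)
  have [v ->] := surj i p w; move=> /Ws_in DvW; apply: memv_img; apply/Ws_in => -[|n].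
    rewrite leNgt; apply/negP => /expandF[+ _].
    by rewrite ltNge; have := DvW 0%N; rewrite /= => ->.
  by rewrite iterSr; exact: DvW.
- move=> i p; apply/eqP; rewrite eqEsubv; apply/andP; split; apply/subvP => w.
    move=> /memv_imgP[v /Wu_in vW ->]; apply/Wu_in => -[|n].
      (* Here the condition missing from the backward orbit of v is that at Dg v itself. *)
      rewrite leNgt; apply/negP => h; have [+ _] := contractF (z := tot (tv p v)) h.
      by rewrite ltNge; have := vW 0%N; rewrite /= => ->.
    rewrite iterSr -[tot (tv (g i p) _)]/(tot_fwd g (tot (tv p v))) tot_fwdK.
    exact: vW.
  have [v ->] := surj i p w; move=> /Wu_in DvW; apply: memv_img; apply/Wu_in => n.
  have := DvW n.+1; rewrite iterSr -[tot (tv (g i p) _)]/(tot_fwd g (tot (tv p v))).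
  by rewrite tot_fwdK.
exists rho, (4 * C); split; first by rewrite rho0 rho1.
  by rewrite mulr_gt0.
move=> i n p n1; split=> v.
  move=> /Ws_in vW; pose z := tot (tv p v).
  have hc := half_contract (@iter_tot_fwd R M g) al0 al1 rho0
    (ap_a_sn ap) contractF2 vW n.
  rewrite -[leLHS]/(tnrm (tot (tmap (@fwd_iter R M g n i) (tv p v)))) -iter_tot_fwd.
  have h0 := tnrm_proj_le z cap full.
  exact: (orbit_bound (ap_C ap) alE (exprn_ge0 n (ltW rho0)) h0 (ap_b_ge ap z)
    (vW 0%N) (ap_a_le ap z) (a0 z) hc (vW n) (a0 _) (tnrm_le _)).
move=> /Wu_in vW; pose z := tot (tv p v).
have hc := half_contract (@iter_tot_bwd R M g) al0 al1 rho0
  (ap_b_sn ap) contractB vW n.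
rewrite -[leLHS]/(tnrm (tot (tmap (@bwd_iter R M g n i) (tv p v)))) -iter_tot_bwd.
have h0 := tnrm_proj_le z cap' full'.
have h1 z' : tnrm z' <= b z' + a z' by rewrite addrC.
exact: (orbit_bound (ap_C ap) alE (exprn_ge0 n (ltW rho0)) h0 (ap_a_ge ap z)
  (vW 0%N) (ap_b_le ap z) (b0 z) hc (vW n) (b0 _) (h1 _)).
Qed.

End Perturb.

Lemma anosov_ball (d : forall i, diffeo (M i) (M (i + 1)) -> diffeo (M i) (M (i + 1)) -> R)
    (f : diffeo_family M) :
  (forall i, compact [set: M i]) -> (forall i, C1_metric (d i)) -> anosov f ->
  exists eps : int -> R, (forall i, 0 < eps i) /\ strong_ball d f eps `<=` @anosov R M.
Proof.
move=> cM dC1 [Es [Eu hs]].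
have [a [b [C [mu ap]]]] := anosov_adapted hs.
pose al := (2 * C)^-1; pose tau := (1 - mu) / 2.
pose delta := tau * al / (1 + al); pose rho := (1 + mu) / 2.
have delta0 : 0 < delta.
  have al0 : 0 < al by rewrite invr_gt0 mulr_gt0 // (lt_le_trans _ (ap_C ap)).
  by rewrite /delta divr_gt0 ?addr_gt0 // mulr_gt0 // divr_gt0 // subr_gt0 (ap_mu1 ap).
(* delta is fixed from C and mu before i; only the radius e depends on the index. The third estimate
   applies [C1_close] to a composed with the derivative of the inverse of f. *)
have H i : exists e, 0 < e /\ forall g : diffeo (M i) (M (i + 1)), d i (f i) g < e ->
    forall x : tm (M i),
    [/\ `|a (tot (tmap (f i) x)) - a (tot (tmap g x))| <= delta * nrm x,
       `|b (tot (tmap (f i) x)) - b (tot (tmap g x))| <= delta * nrm x &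
       `|a (tot_bwd f (tot (tmap (f i) x))) - a (tot_bwd f (tot (tmap g x)))| <=
         delta * nrm x].
  have [e1 e10 h1] := C1_close (f i) (cM i) (dC1 i) (ap_a_c ap (i :=
    i + 1)) (ap_a_sn ap (i + 1)) delta0.
  have [e2 e20 h2] := C1_close (f i) (cM i) (dC1 i) (ap_b_c ap (i :=
    i + 1)) (ap_b_sn ap (i + 1)) delta0.
  have cB := tcont_tmap (C1_inv_step f (i + 1)) (ap_a_c ap (i := i + 1 - 1)).
  have sB := fsn_tmap (@inv_step R M f (i + 1)) (ap_a_sn ap (i + 1 - 1)).
  have [e3 e30 h3] := C1_close (f i) (cM i) (dC1 i) cB sB delta0.
  exists (Num.min e1 (Num.min e2 e3)); split; first by rewrite !lt_min e10 e20.
  move=> g; rewrite !lt_min => /and3P[g1 g2 g3] x.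
  by split; [exact: h1|exact: h2|exact: h3].
have /boolp.choice[eps epsE] := H.
exists eps; split; first by move=> i; have [] := epsE i.
move=> g gB.
have gE i (x : tm (M i)) := (epsE i).2 (g i) (gB i) x.
apply: (perturbed_anosov (g := g) hs ap (al := al) (tau := tau) (delta :=
  delta) (rho := rho)) => //.
- by move=> [i x]; have [] := gE i x.
- by move=> [i x]; have [] := gE i x.
- by move=> [i x]; have [] := gE i x.
Qed.

End Perturbation.

Theorem theorem5p4 (R : realType) (M : int -> riemannian R)
  (M_compact : forall i, compact [set: M i])
  (d : forall i, diffeo (M i) (M (i + 1)) -> diffeo (M i) (M (i + 1)) -> R)
  (d_C1 : forall i, C1_metric (d i)) :
  strong_topology d (@anosov R M) /\
  forall f : diffeo_family M, anosov f ->
    exists eps : int -> R,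
      (forall i, 0 < eps i) /\ strong_ball d f eps `<=` @anosov R M.
Proof.
have ball f : anosov f -> exists eps : int -> R,
    (forall i, 0 < eps i) /\ strong_ball d f eps `<=` @anosov R M.
  exact: anosov_ball.
split => // O [[_ _ Ounion] GO].
(* Closure under unions suffices: each Anosov family lies in its own ball, as d vanishes on the
   diagonal, and the ball is a generator. *)
have -> : @anosov R M = \bigcup_(B in [set B | O B /\ B `<=` @anosov R M]) B.
  apply/seteqP; split => [f Af|f [B [_ BA] Bf]]; last exact: BA.
  have [eps [eps0 epsA]] := ball f Af.
  exists (strong_ball d f eps); first by split => //; apply: GO; exists f, eps.
  move=> i; have [[_ d0 _ _] _] := d_C1 i.
  by rewrite (d0 _ _).2.
by apply: Ounion => B [].
Qed.
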